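(* 1. Assume that FOSCMS is fulfilled for $M_{\bar\omega}$ at $\bar x$, i.e., for every direction $0\neq u\in T^{\rm lin}_{\bar\omega}(\bar x)$ one has $$\nabla_xq(\bar x,\bar\omega)^T\lambda=0,\ \lambda\in N(q(\bar x,\bar\omega);P;\nabla_xq(\bar x,\bar\omega)u)\ \Longrightarrow\ \lambda=0.$$ Then property $R_1$ holds. 2. If for every direction $0\neq u\in T^{\rm lin}_{\bar\omega}(\bar x)$ one has $$\nabla_xq(\bar x,\bar\omega)^T\lambda=0,\ \lambda\in N(q(\bar x,\bar\omega);P;\nabla_xq(\bar x,\bar\omega)u),\ u^T\nabla_x^2(\lambda^Tq)(\bar x,\bar\omega)u=0\ \Longrightarrow\ \lambda=0,$$ then property $R_2$ holds. In particular, SOSCMS for $M_{\bar\omega}$ at $\bar x$ implies property $R_2$.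
   Context: Setting. $\Omega$ is a topological space, $\bar\omega\in\Omega$; $q:\mathbb R^n\times\Omega\to\mathbb R^m$ is continuous; $P=\bigcup_{i=1}^pP_i\subset\mathbb R^m$ is a finite union of convex polyhedra $P_i=\{y\mid a_{ij}^Ty\le b_{ij},\ j=1,\dots,m_i\}$. $\mathcal F(\omega):=\{x\in\mathbb R^n\mid q(x,\omega)\in P\}$, $\bar x\in\mathcal F(\bar\omega)$, and $M_\omega(x):=q(x,\omega)-P$. $\|\cdot\|$ is the Euclidean norm (and the associated operator norm), ${\rm d}(\cdot,\cdot)$ the distance to a set. Standing assumption. There are neighborhoods $U_0$ of $\bar x$ and $W_0$ of $\bar\omega$ such that $q$ is twice partially differentiable with respect to $x$ on $U_0\times W_0$; $q,\nabla_xq,\nabla_x^2q$ are continuous at $(\bar x,\bar\omega)$; and $\nabla_x^2q(\cdot,\omega)$ is continuous on $U_0$ for every $\omega\in W_0$. Cones. For $\Gamma\subset\mathbb R^d$ and $x\in\Gamma$: $T(x;\Gamma):=\{u\mid\exists u_k\to u,\ t_k\downarrow0:\ x+t_ku_k\in\Gamma\}$; $\hat N(x;\Gamma):=\{\xi\mid\limsup_{x'\to x,\,x'\in\Gamma}\xi^T(x'-x)/\|x'-x\|\le0\}$ (empty if $x\notin\Gamma$); $N(x;\Gamma;u):=\{\xi\mid\exists t_k\downarrow0,\ u_k\to u,\ \xi_k\to\xi:\ \xi_k\in\hat N(x+t_ku_k;\Gamma)\ \forall k\}$. $T^{\rm lin}_{\omega}(x):=\{u\mid\nabla_xq(x,\omega)u\in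 T(q(x,\omega);P)\}$. $e_l(\omega):=\|\nabla_xq(\bar x,\omega)-\nabla_xq(\bar x,\bar\omega)\|+\|q(\bar x,\omega)-q(\bar x,\bar\omega)\|^{1/l}$, $l\in\{1,2\}$. Metric regularity. A multifunction $M$ is metrically regular with modulus $\kappa>0$ around $(x_0,y_0)\in{\rm gph}\,M$ if there are neighborhoods $U'$ of $x_0$ and $V'$ of $y_0$ with ${\rm d}(x,M^{-1}(y))\le\kappa\,{\rm d}(y,M(x))$ for all $(x,y)\in U'\times V'$. Property $R_l$ ($l\in\{1,2\}$) holds if there are neighborhoods $U$ of $\bar x$, $W$ of $\bar\omega$ and constants $\kappa>0$, $\gamma>0$ such that for every $\omega\in W$ and every $x\in\mathcal F(\omega)\cap U$ with $\|x-\bar x\|>\gamma e_l(\omega)$ the multifunction $M_\omega$ is metrically regular with modulus $\kappa$ around $(x,0)$. SOSCMS for $M_{\bar\omega}$ at $\bar x$: for every $0\neq u\in T^{\rm lin}_{\bar\omega}(\bar x)$, [$\nabla_xq(\bar x,\bar\omega)^T\lambda=0$, $\lambda\in N(q(\bar x,\bar\omega);P;\nabla_xq(\bar x,\bar\omega)u)$, $u^T\nabla_x^2(\lambda^Tq)(\bar x,\bar\omega)u\ge0$] implies $\lambda=0$. *)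

(* Defs.v *)
From HB Require Import structures.
From mathcomp Require Import all_boot all_order all_algebra.
From mathcomp Require Import all_classical all_reals all_analysis.
Set Implicit Arguments.
Unset Strict Implicit.
Unset Printing Implicit Defensive.
Import Order.TTheory GRing.Theory Num.Theory.
Import numFieldNormedType.Exports.
Local Open Scope classical_set_scope.
Local Open Scope ring_scope.

(* The space R^d is the type 'rV[R]_d of row vectors.  The norm `|x| of the
   library is the sup norm; it is used only through the topology and the
   derivatives it induces.  All metric quantities use the Euclidean norm
   enorm below. *)

Section Euclidean.
Context {R : realType}.
Implicit Types d n m : nat.

Definition dotv d (u v : 'rV[R]_d) : R := \sum_i u 0 i * v 0 i.

Definition enorm d (u : 'rV[R]_d) : R := Num.sqrt (dotv u u).

(* Operator norm of u |-> u *m A, both spaces carrying the Euclidean norm. *)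
Definition opnorm n m (A : 'M[R]_(n, m)) : R :=
  sup [set enorm (u *m A) | u in [set u : 'rV[R]_n | enorm u <= 1]].

(* Distance to a set, equal to +oo when the set is empty. *)
Definition edistance d (x : 'rV[R]_d) (A : set 'rV[R]_d) : \bar R :=
  ereal_inf [set (enorm (x - z))%:E | z in A].

Definition convex_polyhedron d k (a : 'I_k -> 'rV[R]_d) (b : 'I_k -> R) :
    set 'rV[R]_d :=
  [set y | forall j, dotv (a j) y <= b j].

End Euclidean.

Section Cones.
Context {R : realType} {d : nat}.
Implicit Types (G : set 'rV[R]_d) (x u : 'rV[R]_d).

Definition decreases_to0 (t : nat -> R) : Prop :=
  (forall k, 0 < t k) /\ t @ \oo --> (0 : R).

Definition tangent_cone x G : set 'rV[R]_d :=
  [set u | exists (u_ : nat -> 'rV[R]_d) (t_ : nat -> R),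
     [/\ u_ @ \oo --> u, decreases_to0 t_ & forall k, G (x + t_ k *: u_ k)]].

(* The upper limit is taken over x' in G with x' != x; if x is isolated in G
   it is -oo, so that the cone is the whole space. *)
Definition regular_normal_cone x G : set 'rV[R]_d :=
  [set xi | G x /\
     (limf_esup (fun x' => (dotv xi (x' - x) / enorm (x' - x))%:E)
                (within (G `\ x) (nbhs x)) <= 0)%E].

Definition directional_normal_cone x G u : set 'rV[R]_d :=
  [set xi | exists (t_ : nat -> R) (u_ xi_ : nat -> 'rV[R]_d),
     [/\ decreases_to0 t_, u_ @ \oo --> u, xi_ @ \oo --> xi &
         forall k, regular_normal_cone (x + t_ k *: u_ k) G (xi_ k)]].

End Cones.

Definition metrically_regular {R : realType} {n m : nat}
    (M : 'rV[R]_n -> set 'rV[R]_m) (kappa : R)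
    (x0 : 'rV[R]_n) (y0 : 'rV[R]_m) : Prop :=
  [/\ 0 < kappa, M x0 y0 &
      exists (U : set 'rV[R]_n) (V : set 'rV[R]_m),
        [/\ nbhs x0 U, nbhs y0 V &
            forall x y, U x -> V y ->
              (edistance x [set z | M z y] <= kappa%:E * edistance y (M x))%E]].

Section Hessian.
Context {R : realType} {n : nat}.

Definition gradient (f : 'rV[R]_n -> R^o) (x : 'rV[R]_n) : 'rV[R]_n :=
  \row_(j < n) 'D_(delta_mx 0 j) f x.

Definition hessian (f : 'rV[R]_n -> R^o) (x : 'rV[R]_n) : 'M[R]_n :=
  'J (gradient f) x.

Definition quadform (A : 'M[R]_n) (u : 'rV[R]_n) : R := dotv (u *m A) u.

End Hessian.

Section ParametricConstraint.
Context {R : realType} {n m : nat} {Omega : topologicalType}.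
Variables (q : 'rV[R]_n -> Omega -> 'rV[R]_m) (P : set 'rV[R]_m).

Definition feasible (w : Omega) : set 'rV[R]_n := [set x | P (q x w)].

Definition constraint_map (w : Omega) (x : 'rV[R]_n) : set 'rV[R]_m :=
  [set q x w - z | z in P].

(* The Jacobian of the library acts on row vectors from the right, hence it is
   the transpose of the usual m x n matrix grad_x q(x,w):
   grad_x q(x,w) u is u *m Dx x w, and
   grad_x q(x,w)^T lambda is lambda *m (Dx x w)^T. *)
Definition Dx (x : 'rV[R]_n) (w : Omega) : 'M[R]_(n, m) := 'J (q^~ w) x.

Definition hess_x (lambda : 'rV[R]_m) (x : 'rV[R]_n) (w : Omega) : 'M[R]_n :=
  hessian (fun x' => dotv lambda (q x' w)) x.

(* The second derivative grad_x^2 q is the family of the Hessians of the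
   components of q. *)
Definition hess_comp (i : 'I_m) (x : 'rV[R]_n) (w : Omega) : 'M[R]_n :=
  hessian (fun x' => q x' w 0 i) x.

Definition smoothness_assumption (xb : 'rV[R]_n) (wb : Omega) : Prop :=
  exists (U0 : set 'rV[R]_n) (W0 : set Omega),
    [/\ nbhs xb U0, nbhs wb W0,
        forall x w, U0 x -> W0 w ->
          differentiable (q^~ w) x /\ differentiable (Dx^~ w) x,
        [/\ {for (xb, wb), continuous (fun z => q z.1 z.2)},
            {for (xb, wb), continuous (fun z => Dx z.1 z.2)} &
            forall i, {for (xb, wb), continuous (fun z => hess_comp i z.1 z.2)}] &
        forall w, W0 w -> forall i, {within U0, continuous (hess_comp i)^~ w}].

Definition linearized_tangent_cone (w : Omega) (x : 'rV[R]_n) :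
    set 'rV[R]_n :=
  [set u | tangent_cone (q x w) P (u *m Dx x w)].

Definition err (xb : 'rV[R]_n) (wb : Omega) (l : nat) (w : Omega) : R :=
  opnorm (Dx xb w - Dx xb wb) + enorm (q xb w - q xb wb) `^ (l%:R)^-1.

Definition property_R (xb : 'rV[R]_n) (wb : Omega) (l : nat) : Prop :=
  exists (U : set 'rV[R]_n) (W : set Omega) (kappa gamma : R),
    [/\ nbhs xb U, nbhs wb W, 0 < kappa, 0 < gamma &
        forall w x, W w -> (feasible w `&` U) x ->
          gamma * err xb wb l w < enorm (x - xb) ->
          metrically_regular (constraint_map w) kappa x 0].

Definition FOSCMS (w : Omega) (x : 'rV[R]_n) : Prop :=
  forall u, u != 0 -> linearized_tangent_cone w x u ->
  forall lambda : 'rV[R]_m,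
    lambda *m (Dx x w)^T = 0 ->
    directional_normal_cone (q x w) P (u *m Dx x w) lambda ->
    lambda = 0.

Definition SOSCMS (w : Omega) (x : 'rV[R]_n) : Prop :=
  forall u, u != 0 -> linearized_tangent_cone w x u ->
  forall lambda : 'rV[R]_m,
    lambda *m (Dx x w)^T = 0 ->
    directional_normal_cone (q x w) P (u *m Dx x w) lambda ->
    0 <= quadform (hess_x lambda x w) u ->
    lambda = 0.

End ParametricConstraint.

(* Main.v *)
Require Import Defs.
From HB Require Import structures.
From mathcomp Require Import all_boot all_order all_algebra.
From mathcomp Require Import all_classical all_reals all_analysis.
From mathcomp Require Import ring lra.
Set Implicit Arguments.
Unset Strict Implicit.
Unset Printing Implicit Defensive.
Import Order.TTheory GRing.Theory Num.Theory.
Import numFieldNormedType.Exports.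
Local Open Scope classical_set_scope.
Local Open Scope ring_scope.

(** The proof is by contradiction and blow-up at [(xb, wb)].

    If the property fails, then for every accuracy [e] there are a parameter [w]
    and a feasible point [x], as close to [wb] and [xb] as desired and far from
    [xb] relative to the error of [w], where regularity with modulus [e^-1] fails.
    A criterion for metric regularity ([not_metrically_regular_witness], proved by
    minimising over a compact set) turns this into a point [z] near [x], a point
    [p] of [P] near [q z w] and a unit normal [lam] to [P] at [p] that the transposed
    Jacobian of [q^~ w] at [z] almost annihilates.

    Let [t] be the distance of [z] to [xb], and let [u] and [lam] be limits of the
    unit vectors [(z - xb) / t] and of the normals as [e] tends to zero. The shift
    [q xb w - q xb wb] is of order [e * t], so [(p - q xb wb) / t] tends to
    [u *m Dx q xb wb]. Hence [u] is in the linearized tangent cone, [lam] is a unit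
    element of the directional normal cone, and the transposed Jacobian at
    [(xb, wb)] annihilates [lam]; this contradicts the first order condition.

    For the second order condition the shift is of order [e * t ^+ 2] and it
    remains to see that the quadratic form of [lam] vanishes at [u]. Since [P] is
    polyhedral, its points have only finitely many normal cones, all closed; so the
    limit [lam] is a normal at the points [p] themselves
    ([near_normal_to_pieces_sub]), and since [P] is conical near [q xb wb], it is
    orthogonal to [p - q xb wb] ([near_normal_to_pieces_orth]). In the second order
    expansion of [dotv lam (q z w - q xb wb)] everything but the quadratic term is
    then [o(t ^ 2)] ([limit_quadform_eq0]). *)

(** * Euclidean norm and limits of matrices *)

Section EuclideanSpace.
Context {R : realType}.
Implicit Types d n m : nat.

Lemma dotvC d (u v : 'rV[R]_d) : dotv u v = dotv v u.
Proof. by apply: eq_bigr => i _; rewrite mulrC. Qed.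

Lemma dotvDr d (u v w : 'rV[R]_d) : dotv u (v + w) = dotv u v + dotv u w.
Proof. by rewrite -big_split; apply: eq_bigr => i _; rewrite mxE mulrDr. Qed.

Lemma dotvZr d (u v : 'rV[R]_d) c : dotv u (c *: v) = c * dotv u v.
Proof. by rewrite mulr_sumr; apply: eq_bigr => i _; rewrite mxE mulrCA. Qed.

Lemma dotvDl d (u v w : 'rV[R]_d) : dotv (u + v) w = dotv u w + dotv v w.
Proof. by rewrite !(dotvC _ w) dotvDr. Qed.

Lemma dotvZl d (u v : 'rV[R]_d) c : dotv (c *: u) v = c * dotv u v.
Proof. by rewrite !(dotvC _ v) dotvZr. Qed.

Lemma dotvNr d (u v : 'rV[R]_d) : dotv u (- v) = - dotv u v.
Proof. by rewrite -scaleN1r dotvZr mulN1r. Qed.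

Lemma dotvNl d (u v : 'rV[R]_d) : dotv (- u) v = - dotv u v.
Proof. by rewrite !(dotvC _ v) dotvNr. Qed.

Lemma dotvBr d (u v w : 'rV[R]_d) : dotv u (v - w) = dotv u v - dotv u w.
Proof. by rewrite dotvDr dotvNr. Qed.

Lemma dotvBl d (u v w : 'rV[R]_d) : dotv (u - v) w = dotv u w - dotv v w.
Proof. by rewrite dotvDl dotvNl. Qed.

Lemma dotv0 d (u : 'rV[R]_d) : dotv u 0 = 0.
Proof. by apply: big1 => i _; rewrite mxE mulr0. Qed.

Lemma dotv_delta d (u : 'rV[R]_d) i : dotv (delta_mx 0 i) u = u 0 i.
Proof.
rewrite /dotv (bigD1 i)//= mxE !eqxx mul1r big1 ?addr0// => j ji.
by rewrite mxE (negbTE ji) andbF mul0r.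
Qed.

Lemma dotv_mulmx n m (u : 'rV[R]_m) (v : 'rV[R]_n) (A : 'M[R]_(n, m)) :
  dotv u (v *m A) = dotv (u *m A^T) v.
Proof.
have dE d (x y : 'rV[R]_d) : dotv x y = (x *m y^T) 0 0.
  by rewrite mxE; apply: eq_bigr => i _; rewrite mxE.
by rewrite !dE trmx_mul mulmxA.
Qed.

Lemma dotvv_ge0 d (u : 'rV[R]_d) : 0 <= dotv u u.
Proof. by apply: sumr_ge0 => i _; rewrite -expr2 sqr_ge0. Qed.

Lemma enorm_ge0 d (u : 'rV[R]_d) : 0 <= enorm u.
Proof. exact: sqrtr_ge0. Qed.

Lemma sqr_enorm d (u : 'rV[R]_d) : enorm u ^+ 2 = dotv u u.
Proof. by rewrite sqr_sqrtr// dotvv_ge0. Qed.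

Lemma enorm0 d : enorm (0 : 'rV[R]_d) = 0.
Proof. by rewrite /enorm dotv0 sqrtr0. Qed.

Lemma enormZ d (u : 'rV[R]_d) c : enorm (c *: u) = `|c| * enorm u.
Proof.
by rewrite /enorm dotvZl dotvZr mulrA -expr2 sqrtrM ?sqr_ge0// sqrtr_sqr.
Qed.

Lemma enormN d (u : 'rV[R]_d) : enorm (- u) = enorm u.
Proof. by rewrite -scaleN1r enormZ normrN1 mul1r. Qed.

Lemma enormB d (u v : 'rV[R]_d) : enorm (u - v) = enorm (v - u).
Proof. by rewrite -opprB enormN. Qed.

Lemma coord_le_enorm d (u : 'rV[R]_d) i : `|u 0 i| <= enorm u.
Proof.
rewrite -sqrtr_sqr ler_wsqrtr// /dotv (bigD1 i)//= expr2 lerDl.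
by apply: sumr_ge0 => j _; rewrite -expr2 sqr_ge0.
Qed.

Lemma enorm_eq0 d (u : 'rV[R]_d) : enorm u = 0 -> u = 0.
Proof.
move=> u0; apply/rowP => i; rewrite mxE; apply/eqP.
by rewrite -normr_le0 -u0 coord_le_enorm.
Qed.

Lemma dotv_le_enorm d (u v : 'rV[R]_d) : dotv u v <= enorm u * enorm v.
Proof.
have [/enorm_eq0->|u0] := eqVneq (enorm u) 0.
  by rewrite dotvC dotv0 enorm0 mul0r.
have [/enorm_eq0->|v0] := eqVneq (enorm v) 0.
  by rewrite dotv0 enorm0 mulr0.
have uv : 0 < enorm u * enorm v by rewrite mulr_gt0// lt0r ?u0 ?v0 enorm_ge0.
have := dotvv_ge0 (enorm v *: u - enorm u *: v).
rewrite !(dotvBl, dotvBr, dotvZl, dotvZr) -!sqr_enorm (dotvC v u).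
nra.
Qed.

Lemma enormD d (u v : 'rV[R]_d) : enorm (u + v) <= enorm u + enorm v.
Proof.
rewrite -[leRHS]ger0_norm ?addr_ge0 ?enorm_ge0// -sqrtr_sqr ler_wsqrtr//.
rewrite !(dotvDl, dotvDr) -!sqr_enorm (dotvC v u).
by have := dotv_le_enorm u v; nra.
Qed.

Lemma enorm_triangle d (v u w : 'rV[R]_d) :
  enorm (u - w) <= enorm (u - v) + enorm (v - w).
Proof. by apply: le_trans (enormD _ _); rewrite addrA subrK. Qed.

Lemma normr_dotv d (u v : 'rV[R]_d) : `|dotv u v| <= enorm u * enorm v.
Proof.
by rewrite ler_norml dotv_le_enorm lerNl -dotvNr -(enormN v) dotv_le_enorm.
Qed.

Lemma enorm_le_sum d (u : 'rV[R]_d) : enorm u <= \sum_i `|u 0 i|.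
Proof.
have s0 : 0 <= \sum_i `|u 0 i| by apply: sumr_ge0.
rewrite -[leRHS]ger0_norm// -sqrtr_sqr ler_wsqrtr// expr2 mulr_suml.
apply: ler_sum => i _; apply: le_trans (ler_norm _) _; rewrite normrM.
by rewrite ler_wpM2l// (bigD1 i)//= lerDl sumr_ge0.
Qed.

Lemma cvg_sumR {T} {F : set_system T} {FF : Filter F} d
    (f : 'I_d -> T -> R) (l : 'I_d -> R) :
  (forall i, f i @ F --> l i) -> (fun x => \sum_i f i x) @ F --> \sum_i l i.
Proof. by move=> fl; apply: cvg_big => // ; exact: add_continuous. Qed.

Lemma cvg_mxP {T} {F : set_system T} {FF : Filter F} n m
    (f : T -> 'M[R]_(n, m)) (A : 'M[R]_(n, m)) :
  f @ F --> A <-> forall i j, (fun x => f x i j) @ F --> A i j.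
Proof.
split=> [fA i j|fA].
  apply: (cvg_comp _ (fun M : 'M[R]_(n, m) => M i j) fA).
  exact: coord_continuous.
apply/cvgrPdist_lt => e e0.
have : \forall x \near F, forall ij : 'I_n * 'I_m, `|A ij.1 ij.2 - f x ij.1 ij.2| < e.
  by apply: filter_forall => -[i j]; move/cvgrPdist_lt : (fA i j); exact.
apply: filterS => x fx; rewrite [ltLHS]/Num.norm /= mx_normrE.
by apply/bigmax_ltP; split => // ij _; rewrite !mxE.
Qed.

Lemma cvg_mx_dist_le {T} {F : set_system T} {FF : Filter F} n m
    (f : T -> 'M[R]_(n, m)) (A : 'M[R]_(n, m)) e : 0 < e -> f @ F --> A ->
  \forall x \near F, forall i j, `|f x i j - A i j| <= e.
Proof.
move=> e0 /cvg_mxP fA; apply: (@filter_forall _ _ _ F) => i.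
apply: (@filter_forall _ _ _ F) => j; move/cvgrPdist_le : (fA i j) => /(_ e e0).
by apply: filterS => x; rewrite distrC.
Qed.

Lemma cvg_mulmx {T} {F : set_system T} {FF : Filter F} n m p
    (f : T -> 'M[R]_(n, m)) (g : T -> 'M[R]_(m, p))
    (A : 'M[R]_(n, m)) (B : 'M[R]_(m, p)) :
  f @ F --> A -> g @ F --> B -> (fun x => f x *m g x) @ F --> A *m B.
Proof.
move=> /cvg_mxP fA /cvg_mxP gB; apply/cvg_mxP => i j; rewrite mxE.
under eq_fun do rewrite mxE.
by apply: cvg_sumR => k; apply: cvgM.
Qed.

Lemma cvg_trmx {T} {F : set_system T} {FF : Filter F} n m
    (f : T -> 'M[R]_(n, m)) (A : 'M[R]_(n, m)) :
  f @ F --> A -> (fun x => (f x)^T) @ F --> A^T.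
Proof.
move=> /cvg_mxP fA; apply/cvg_mxP => i j; rewrite mxE.
by under eq_fun do rewrite mxE; exact: fA.
Qed.

Lemma cvg_dotv {T} {F : set_system T} {FF : Filter F} d
    (f g : T -> 'rV[R]_d) (u v : 'rV[R]_d) :
  f @ F --> u -> g @ F --> v -> (fun x => dotv (f x) (g x)) @ F --> dotv u v.
Proof. by move=> /cvg_mxP fu /cvg_mxP gv; apply: cvg_sumR => i; apply: cvgM. Qed.

Lemma dotv_continuous d (u : 'rV[R]_d) : continuous (dotv u).
Proof.
by move=> v; apply: (@cvg_dotv _ (nbhs v) _ _ (cst u) id); [exact: cvg_cst|exact: cvg_id].
Qed.

Lemma cvg_enorm {T} {F : set_system T} {FF : Filter F} d
    (f : T -> 'rV[R]_d) (u : 'rV[R]_d) :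
  f @ F --> u -> (fun x => enorm (f x)) @ F --> enorm u.
Proof.
move=> fu; apply: (@cvg_comp _ _ _ (fun x => dotv (f x) (f x)) Num.sqrt _
  (nbhs (dotv u u)) _).
  exact: cvg_dotv.
exact: sqrt_continuous.
Qed.

Lemma cvg_enorm0P {T} {F : set_system T} {FF : Filter F} d
    (f : T -> 'rV[R]_d) (u : 'rV[R]_d) :
  f @ F --> u <-> (fun x => enorm (f x - u)) @ F --> (0 : R).
Proof.
split=> [f_u|f0].
  by rewrite -[X in _ --> X](enorm0 d) -(subrr u); apply: cvg_enorm; apply: cvgB => //;
    exact: cvg_cst.
apply/cvg_mxP => i j; rewrite ord1; apply/cvgrPdist_lt => e e0.
move/cvgrPdist_lt : f0 => /(_ e e0); apply: filterS => x.
rewrite sub0r normrN ger0_norm ?enorm_ge0//; apply: le_lt_trans.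
by rewrite enormB; have := coord_le_enorm (u - f x) j; rewrite !mxE.
Qed.

Lemma near_enorm d (x : 'rV[R]_d) e : 0 < e ->
  \forall z \near x, enorm (z - x) < e.
Proof.
move=> e0; have /cvg_enorm0P/cvgrPdist_lt/(_ e e0) : id @ x --> x by exact: cvg_id.
by apply: filterS => z; rewrite sub0r normrN ger0_norm ?enorm_ge0.
Qed.

(** The topology of row vectors is that of the sup norm, and every neighbourhood
below is a Euclidean ball; this is the passage between the two. *)
Lemma nbhs_enormP d (x : 'rV[R]_d) (U : set 'rV[R]_d) :
  nbhs x U <-> exists2 e, 0 < e & forall z, enorm (z - x) < e -> U z.
Proof.
split=> [/nbhs_ballP[e /= e0 xeU]|[e e0 xeU]]; last first.
  exact: filterS xeU (near_enorm x e0).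
exists e => // z zx; apply: xeU; rewrite -ball_normE /=.
rewrite [ltLHS]/Num.norm /= mx_normrE; apply/bigmax_ltP; split => // -[i j] _ /=.
by apply: le_lt_trans zx; rewrite enormB (ord1 i); exact: coord_le_enorm.
Qed.

Lemma compact_enorm_ball d (x : 'rV[R]_d) r : compact [set z | enorm (z - x) <= r].
Proof.
apply: bounded_closed_compact.
  exists (enorm x + `|r|); split; first exact: num_real.
  move=> M xrM z /= zx; rewrite [leLHS]/Num.norm /= mx_normrE.
  apply/bigmax_leP; split => [|[i j] _ /=].
    by apply: le_trans (ltW xrM); rewrite addr_ge0 ?enorm_ge0.
  rewrite (ord1 i); have := coord_le_enorm z j.
  have := enormD (z - x) x; rewrite subrK => zxx.
  by have := ler_norm r; move: xrM zx zxx; lra.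
rewrite (_ : mkset _ = (fun z => enorm (z - x)) @^-1` [set y | y <= r])//.
apply: closed_comp; last exact: closed_le.
move=> z _; apply: (@cvg_enorm _ (nbhs z) _ _ (fun z => z - x)).
by apply: (@cvgB _ _ _ (nbhs z) _ id (cst x)); [exact: cvg_id|exact: cvg_cst].
Qed.

Lemma mulmx_coord_dist n m (h : 'rV[R]_n) (A B : 'M[R]_(n, m)) e i :
  enorm h <= 1 -> (forall j j', `|A j j' - B j j'| <= e) ->
  `|(h *m A) 0 i - (h *m B) 0 i| <= n%:R * e.
Proof.
move=> h1 AB.
have -> : (h *m A) 0 i - (h *m B) 0 i = (h *m (A - B)) 0 i.
  by rewrite mulmxBr [RHS]mxE [X in _ = _ + X]mxE.
rewrite mxE; apply: le_trans (ler_norm_sum _ _ _) _.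
rewrite -[n in n%:R]card_ord mulr_natl -sumr_const; apply: ler_sum => j _.
rewrite normrM -[e]mul1r; apply: ler_pM => //; last by rewrite !mxE.
exact: le_trans (coord_le_enorm _ _) h1.
Qed.

(** The supremum in [opnorm] is over a bounded set, so that it is an actual upper
bound and not the default value of [sup]. *)
Lemma opnorm_bound n m (A : 'M[R]_(n, m)) (u : 'rV[R]_n) :
  enorm u <= 1 -> enorm (u *m A) <= opnorm A.
Proof.
move=> u1; apply: sup_upper_bound; last by exists u.
split; first by exists (enorm (u *m A)); exists u.
exists (\sum_j \sum_i `|A i j|) => _ [v /= v1 <-].
apply: le_trans (enorm_le_sum _) _; apply: ler_sum => j _.
rewrite mxE; apply: le_trans (ler_norm_sum _ _ _) _; apply: ler_sum => i _.
rewrite normrM ler_piMl//; exact: le_trans (coord_le_enorm _ _) v1.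
Qed.

Lemma opnorm_ge0 n m (A : 'M[R]_(n, m)) : 0 <= opnorm A.
Proof.
by apply: le_trans (@opnorm_bound _ _ A 0 _); rewrite ?mul0mx enorm0 ?ler01.
Qed.

End EuclideanSpace.

(** * Normals to finite unions of polyhedra *)

Section Polyhedra.
Context {R : realType} {d : nat}.
Implicit Types (C : set 'rV[R]_d) (p y lam mu v : 'rV[R]_d).

(** For convex [C] and [p] in [C] this is the regular normal cone, described without
limits. *)
Definition normal_to C p : set 'rV[R]_d :=
  [set lam | forall y, C y -> dotv lam (y - p) <= 0].

Section OnePolyhedron.
Context {k : nat} (a : 'I_k -> 'rV[R]_d) (b : 'I_k -> R).
Let C := convex_polyhedron a b.

Lemma polyhedron_segment p y s : 0 <= s <= 1 -> C p -> C y ->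
  C (p + s *: (y - p)).
Proof.
move=> s01 Cp Cy j; rewrite dotvDr dotvZr dotvBr.
by have := Cp j; have := Cy j; nra.
Qed.

(** Near [y] no constraint that is violated or inactive at [y] changes status: a
piece that comes near [y] contains [y], and activity can only get lost. *)
Lemma near_constraints y : \forall p \near y, forall j,
  (dotv (a j) p <= b j -> dotv (a j) y <= b j) /\
  (dotv (a j) p = b j -> dotv (a j) y = b j).
Proof.
have cvg_a j : dotv (a j) @ y --> dotv (a j) y by exact: dotv_continuous.
apply: (@filter_forall _ _ _ (nbhs y)) => j; case: (ltgtP (dotv (a j) y) (b j)) => ajy.
- have : \forall p \near y, dotv (a j) p < b j.
    exact: (cvgr_lt _ (cvg_a j)).
  by apply: filterS => p pb; split=> // pE; move: pb; rewrite pE ltxx.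
- have : \forall p \near y, b j < dotv (a j) p.
    exact: (cvgr_gt _ (cvg_a j)).
  by apply: filterS => p pb; split=> [|pE]; [rewrite leNgt pb|move: pb; rewrite pE ltxx].
- by apply: nearW => p; split.
Qed.

Lemma near_polyhedron y : \forall p \near y, C p -> C y.
Proof. by apply: filterS (near_constraints y) => p py Cp j; apply: (py j).1. Qed.

(** The normal cone of a polyhedron depends on the point only through the set of
active constraints: inactive ones do not obstruct a short step along [v]. *)
Lemma normal_to_polyhedronP p lam : C p -> normal_to C p lam <->
  forall v, (forall j, dotv (a j) p = b j -> dotv (a j) v <= 0) ->
    dotv lam v <= 0.
Proof.
move=> Cp; split=> [lamN v v0|lamv y Cy]; last first.
  by apply: lamv => j jp; rewrite dotvBr jp subr_le0; exact: Cy.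
have : \forall s \near (0 : R)^'+, forall j, dotv (a j) (p + s *: v) <= b j.
  apply: filter_forall => j; have [jp|jp] := eqVneq (dotv (a j) p) (b j).
    apply: filterS (nbhs_right_gt (0 : R)) => s s0.
    by rewrite dotvDr dotvZr jp gerDl pmulr_rle0// v0.
  have pj : dotv (a j) p < b j by rewrite lt_neqAle jp Cp.
  have : dotv (a j) (p + s *: v) @[s --> (0 : R)] --> dotv (a j) p.
    have -> : dotv (a j) p = dotv (a j) p + 0 * dotv (a j) v by rewrite mul0r addr0.
    under eq_fun do rewrite dotvDr dotvZr.
    by apply: cvgD; [exact: cvg_cst|apply: cvgMl; exact: cvg_id].
  move=> /cvg_at_right_filter /(cvgr_lt _) /(_ _ pj).
  by apply: filterS => s /ltW.
move=> Cs; near (0 : R)^'+ => s.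
have s0 : 0 < s by near: s; exact: nbhs_right_gt.
have : dotv lam (p + s *: v - p) <= 0 by apply: lamN; near: s.
by rewrite addrC addrA addNr add0r dotvZr pmulr_rle0.
Unshelve. all: by end_near. Qed.

(** Only finitely many cones occur as normal cones of a polyhedron, one for each
set of active constraints, and each of them is closed. Those that miss [lam]
therefore miss a common neighbourhood of [lam]. The point [p] is arbitrary: this
uniformity is what lets a limit of normals at varying points be a normal at
these very points. *)
Lemma near_normal_to_sub lam : \forall mu \near lam, forall p, C p ->
  normal_to C p mu -> normal_to C p lam.
Proof.
(* [K A] is the normal cone at any point whose active set is [A]. *)
pose K (A : {set 'I_k}) : set 'rV[R]_d := [set xi | forall v,
  (forall j, j \in A -> dotv (a j) v <= 0) -> dotv xi v <= 0].
have : \forall mu \near lam, forall A, K A mu -> K A lam.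
  apply: (@filter_forall _ _ _ (nbhs lam)) => A; have [lamA|lamA] := pselect (K A lam).
    exact: nearW.
  have [v vA lamv] : exists2 v,
      (forall j, j \in A -> dotv (a j) v <= 0) & 0 < dotv lam v.
    apply: contrapT => nv; apply: lamA => v vA; rewrite leNgt; apply/negP => lv.
    by apply: nv; exists v.
  rewrite dotvC in lamv; have muv : \forall mu \near lam, 0 < dotv v mu.
    exact: (cvgr_gt _ (@dotv_continuous _ _ v lam) _ lamv).
  by apply: filterS muv => mu muv /(_ v vA); rewrite leNgt dotvC muv.
apply: filterS => mu Kmu p Cp /(normal_to_polyhedronP _ Cp) muN.
apply/(normal_to_polyhedronP _ Cp) => v v0.
apply: (Kmu [set j | dotv (a j) p == b j]%SET) => [w w0|j].
  by apply: muN => j jp; apply: w0; rewrite inE jp.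
by rewrite inE => /eqP; exact: v0.
Qed.

(** Near a point [y] of it, a polyhedron is a cone with apex [y], so that from [p]
both directions [p - y] and [y - p] are feasible, and a normal at [p] is orthogonal to them. *)
Lemma near_normal_to_orth y : \forall p \near y, C p -> forall lam,
  normal_to C p lam -> dotv lam (p - y) = 0.
Proof.
apply: filterS (near_constraints y) => p py Cp lam /(normal_to_polyhedronP _ Cp).
have Cy : C y by move=> j; apply: (py j).1.
move=> lamN; apply/eqP; rewrite eq_le lamN/=; last first.
  by move=> j jp; rewrite dotvBr jp (py j).2// subrr.
rewrite -oppr_le0 -dotvNr opprB lamN// => j jp.
by rewrite dotvBr jp subr_le0; exact: Cy.
Qed.

End OnePolyhedron.

Section UnionOfPolyhedra.
Context {r : nat} {k : 'I_r -> nat}.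
Variables (a : forall i : 'I_r, 'I_(k i) -> 'rV[R]_d).
Variables (b : forall i : 'I_r, 'I_(k i) -> R).
Let C i := convex_polyhedron (@a i) (@b i).
Let P := \bigcup_(i in [set: 'I_r]) C i.

(** The tangent cone of a union is the union of the tangent cones of the pieces, so
at a point of the union these are exactly the regular normals. Minimisation
produces normals in this form, and finiteness arguments use them in it. *)
Definition normal_to_pieces p : set 'rV[R]_d :=
  [set lam | forall i, C i p -> normal_to (C i) p lam].

Lemma closed_union_polyhedra : closed P.
Proof.
move=> y Py; have : \forall p \near y, forall i, C i p -> C i y.
  by apply: (@filter_forall _ _ _ (nbhs y)) => i; exact: near_polyhedron.
by move=> /Py [p [[i _ Cip] py]]; exists i => //; exact: py.
Qed.

Lemma normal_to_pieces_regular p lam :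
  P p -> normal_to_pieces p lam -> regular_normal_cone p P lam.
Proof.
move=> Pp lamN; split=> //.
have near_p : \forall y \near p, forall i, C i y -> C i p.
  by apply: (@filter_forall _ _ _ (nbhs p)) => i; exact: near_polyhedron.
apply: ge_ereal_inf; eexists.
  exists [set y | (P `\ p) y /\ forall i, C i y -> C i p]; last by [].
  by rewrite /within /=; apply: filterS near_p => y yp Py; split.
apply: ge_ereal_sup => _ [y /= [[[i _ Ciy] _] yp] <-]; rewrite lee_fin.
have Cip : C i p by exact: yp.
by rewrite mulr_le0_ge0 ?invr_ge0 ?enorm_ge0//; exact: (lamN i).
Qed.


Lemma near_normal_to_pieces_sub lam : \forall mu \near lam, forall p,
  normal_to_pieces p mu -> normal_to_pieces p lam.
Proof.
have : \forall mu \near lam, forall i p, C i p ->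
    normal_to (C i) p mu -> normal_to (C i) p lam.
  by apply: (@filter_forall _ _ _ (nbhs lam)) => i; exact: near_normal_to_sub.
by apply: filterS => mu muC p muN i Cip; apply: muC => //; exact: muN.
Qed.

Lemma near_normal_to_pieces_orth y : \forall p \near y, P p -> forall lam,
  normal_to_pieces p lam -> dotv lam (p - y) = 0.
Proof.
have : \forall p \near y, forall i, C i p -> forall lam,
    normal_to (C i) p lam -> dotv lam (p - y) = 0.
  by apply: (@filter_forall _ _ _ (nbhs y)) => i; exact: near_normal_to_orth.
by apply: filterS => p pC [i _ Cip] lam /(_ i Cip); exact: pC.
Qed.

End UnionOfPolyhedra.
End Polyhedra.

(** * One-dimensional calculus along lines *)

Section Calculus.
Context {R : realType}.

(** Directional derivatives as plain limits of difference quotients, to which the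
rules for limits apply. *)
Lemma is_deriveP (V W : normedModType R) (f : V -> W) x v df :
  is_derive x v f df <->
  t^-1 *: (f (t *: v + x) - f x) @[t --> (0 : R)^'] --> df.
Proof.
split=> [[fx <-]|fdf]; first exact: fx.
split; first by apply/cvg_ex; exists df.
exact/cvg_lim.
Qed.

Lemma is_derive_line (V W : normedModType R) (f : V -> W) x h s df :
  is_derive (x + s *: h) h f df -> is_derive s 1 (fun t : R => f (x + t *: h)) df.
Proof.
move=> /is_deriveP fh; apply/is_deriveP.
by under eq_fun => t do rewrite [t *: 1]mulr1 scalerDl addrCA.
Qed.

Lemma is_derive_dotv (V : normedModType R) d (f : V -> 'rV[R]_d) x v df mu :
  is_derive x v f df -> is_derive x v (fun y => dotv mu (f y) : R) (dotv mu df).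
Proof.
move=> /is_deriveP fdf; apply/is_deriveP.
under eq_fun do rewrite -dotvBr -[_ *: _]dotvZr.
exact: (cvg_comp _ (dotv mu) fdf (@dotv_continuous _ _ mu df)).
Qed.

Lemma is_derive_sqr_enorm (V : normedModType R) d (f : V -> 'rV[R]_d) x v df :
  is_derive x v f df ->
  t^-1 * (enorm (f (t *: v + x)) ^+ 2 - enorm (f x) ^+ 2) @[t --> (0 : R)^']
    --> 2 * dotv (f x) df.
Proof.
move=> /is_deriveP; pose Q t := t^-1 *: (f (t *: v + x) - f x); rewrite -/(Q _) => fdf.
have -> : 2 * dotv (f x) df = 2 * dotv (f x) df + 0 * dotv df df.
  by rewrite mul0r addr0.
have : 2 * dotv (f x) (Q t) + t * dotv (Q t) (Q t) @[t --> (0 : R)^'] -->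
    2 * dotv (f x) df + 0 * dotv df df.
  apply: cvgD.
    apply: cvgMr; exact: (cvg_comp _ (dotv (f x)) fdf (@dotv_continuous _ _ _ df)).
  apply: cvgM; last exact: cvg_dotv.
  by apply: cvg_within_filter; exact: cvg_id.
apply: cvg_trans; apply: near_eq_cvg; near=> t.
have t0 : t != 0 by near: t; exact: nbhs_dnbhs_neq.
have -> : f (t *: v + x) = f x + t *: Q t.
  by rewrite /Q scalerA divff// scale1r subrKC.
move: (Q t) => w; rewrite !sqr_enorm !(dotvDl, dotvDr, dotvZl, dotvZr) (dotvC _ (f x)).
by field.
Unshelve. all: by end_near. Qed.

Lemma Rolle_is_derive (f df : R -> R) (a b : R) : a < b ->
  (forall s : R, a <= s <= b -> is_derive s 1 f (df s)) -> f a = f b ->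
  exists2 s : R, a < s < b & df s = 0.
Proof.
move=> ab fdf fab; have [||//|s sab fs] := @Rolle _ f a b ab.
- by move=> s; rewrite in_itv/= => /andP[a_s s_b]; have [] := fdf s; rewrite ?ltW.
- apply: continuous_in_subspaceT => s; rewrite inE/= in_itv/= => sab.
  apply: differentiable_continuous; apply/derivable1_diffP.
  by have [] := fdf s sab.
exists s; first by move: sab; rewrite in_itv.
move: sab; rewrite in_itv/= => /andP[a_s s_b].
have fs' : is_derive s 1 f (df s) by apply: fdf; rewrite !ltW.
by rewrite -(@derive_val _ _ _ _ _ _ _ fs') (@derive_val _ _ _ _ _ _ _ fs).
Qed.

Lemma mean_value_unit (f df : R -> R) :
  (forall s : R, 0 <= s <= 1 -> is_derive s 1 f (df s)) ->
  exists2 s : R, 0 <= s <= 1 & f 1 - f 0 = df s.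
Proof.
move=> fdf; pose c := f 1 - f 0.
have [||s s01 /eqP] := @Rolle_is_derive
    (fun s => f s - c * s) (fun s => df s - c) 0 1 ltr01.
- move=> s s01; have fs := fdf s s01; apply: is_derive_eq.
  by rewrite [c *: _]mulr1.
- by rewrite /c; lra.
- rewrite subr_eq0 => /eqP dfs; exists s; last by rewrite dfs.
  by move: s01 => /andP[] /ltW-> /ltW->.
Qed.

(** Taylor with Lagrange remainder, by the classical device: the constant [c] is
chosen so that the difference between [f] and its quadratic model vanishes at
both ends, and Rolle is applied twice. *)
Lemma taylor2_unit (f df ddf : R -> R) :
  (forall s : R, 0 <= s <= 1 -> is_derive s 1 f (df s)) ->
  (forall s : R, 0 <= s <= 1 -> is_derive s 1 df (ddf s)) ->
  exists2 s : R, 0 <= s <= 1 & f 1 - f 0 = df 0 + ddf s / 2.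
Proof.
move=> fdf dfddf; pose c := 2 * (f 1 - f 0 - df 0).
have [||s /andP[s0 s1] gs] := @Rolle_is_derive
    (fun s => f s - df 0 * s - c / 2 * s ^+ 2)
    (fun s => df s - df 0 - c * s) 0 1 ltr01.
- move=> s s01; have fs := fdf s s01; apply: is_derive_eq.
  by rewrite /GRing.scale/=; field.
- by rewrite /c; lra.
have [||r /andP[r0 r1] /eqP] := @Rolle_is_derive
    (fun s => df s - df 0 - c * s) (fun s => ddf s - c) 0 s s0.
- move=> r /andP[r0 r1]; have dfr : is_derive r 1 df (ddf r).
    by apply: dfddf; rewrite r0 (le_trans r1 (ltW s1)).
  apply: is_derive_eq.
  by rewrite /GRing.scale/= mulr1 subr0.
- by rewrite gs; lra.
rewrite subr_eq0 => /eqP ddfr; exists r.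
  by rewrite ltW//= (le_trans (ltW r1) (ltW s1)).
by rewrite ddfr /c; lra.
Qed.

Lemma differentiable_is_derive n m (f : 'rV[R]_n -> 'rV[R]_m) x h :
  differentiable f x -> is_derive x h f (h *m 'J f x).
Proof. by move=> fx; split; [exact: diff_derivable|exact: deriveEjacobian]. Qed.

End Calculus.

(** * Metric regularity and normals *)

Section RegularityCriterion.
Context {R : realType} {n m r : nat} {k : 'I_r -> nat}.
Variables (a : forall i : 'I_r, 'I_(k i) -> 'rV[R]_m).
Variables (b : forall i : 'I_r, 'I_(k i) -> R).
Let P := \bigcup_(i in [set: 'I_r]) convex_polyhedron (@a i) (@b i).

(** Each piece through [p] is convex and [p] is locally nearest to [g] in it, so
[g - p] makes an obtuse angle with every segment that starts at [p]. A local
minimum is enough because the segments shrink to [p]. *)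
Lemma nearest_normal_to_pieces (g p : 'rV[R]_m) e : 0 < e -> P p ->
  (forall p', P p' -> enorm (p' - p) < e -> enorm (g - p) <= enorm (g - p')) ->
  normal_to_pieces a b p (g - p).
Proof.
move=> e0 Pp pmin i Cip y Ciy; set v := y - p; set w := g - p in pmin *.
rewrite leNgt; apply/negP => wv.
have v1 : 0 < 1 + enorm v by rewrite ltr_pwDl ?enorm_ge0.
have v2 : 0 < 1 + enorm v ^+ 2 by rewrite ltr_pwDl ?sqr_ge0.
near (0 : R)^'+ => s.
have s0 : 0 < s by near: s; exact: nbhs_right_gt.
have s1 : s < 1 by near: s; exact: nbhs_right_lt.
have sv : s * (1 + enorm v) < e.
  rewrite -ltr_pdivlMr//; near: s; apply: nbhs_right_lt; exact: divr_gt0.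
have svw : s * (1 + enorm v ^+ 2) < dotv w v.
  rewrite -ltr_pdivlMr//; near: s; apply: nbhs_right_lt; exact: divr_gt0.
have := pmin (p + s *: v); rewrite [_ + _ - p]addrC addKr opprD addrA -/w.
rewrite enormZ gtr0_norm// => /(_ _ _)/wrap[].
  by exists i => //; apply: polyhedron_segment => //; rewrite !ltW.
  by have := enorm_ge0 v; nra.
apply/negP; rewrite -ltNge -(ltr_pXn2r (_ : 0 < 2)%N) ?nnegrE ?enorm_ge0//.
clearbody v w; rewrite !sqr_enorm !(dotvBl, dotvBr, dotvZl, dotvZr).
rewrite (dotvC v w) -(sqr_enorm v).
by have := enorm_ge0 v; nra.
Unshelve. all: by end_near. Qed.

Lemma normal_to_piecesZ p lam c : 0 <= c ->
  normal_to_pieces a b p lam -> normal_to_pieces a b p (c *: lam).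
Proof.
by move=> c0 lamN i Cip y Ciy; rewrite dotvZl mulr_ge0_le0// (lamN i).
Qed.

(** If [z] locally minimises the distance of [f] to [g] up to the slope [c] along
[h], the derivative of that distance along [h] is at least [- c]. The squared
distance is differentiated, so the norm of [f z - g] appears as a factor. *)
Lemma directional_slope (f : 'rV[R]_n -> 'rV[R]_m) z h g c : 0 < enorm (f z - g) ->
  differentiable f z ->
  (\forall s \near (0 : R)^'+,
     enorm (f z - g) <= enorm (f (z + s *: h) - g) + c * s) ->
  - (c * enorm (f z - g)) <= dotv (f z - g) (h *m 'J f z).
Proof.
move=> fz0 fz fmin.
have dfz : is_derive z h (fun y => f y - g) (h *m 'J f z).
  have := differentiable_is_derive h fz => ?.
  by apply: is_derive_eq; rewrite subr0.
set w := enorm (f z - g) in fz0 fmin *.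
have slope : t^-1 * (enorm (f (t *: h + z) - g) ^+ 2 - w ^+ 2)
    @[t --> (0 : R)^'+] --> 2 * dotv (f z - g) (h *m 'J f z).
  apply: cvg_trans (is_derive_sqr_enorm dfz); apply: cvg_app.
  move=> A /nbhs_ballP[_ /posnumP[d] dA].
  by exists d%:num => //= y dy /gt_eqF/negbT/dA; exact.
suff : - (2 * (c * w)) <= 2 * dotv (f z - g) (h *m 'J f z) by lra.
apply: cvgr_to_ge slope _; near=> s.
have s0 : 0 < s by near: s; exact: nbhs_right_gt.
have ws : s * (1 + `|c|) < w.
  have c0 : 0 < 1 + `|c| by rewrite ltr_pwDl.
  rewrite -ltr_pdivlMr//; near: s; apply: nbhs_right_lt; rewrite divr_gt0//.
have : w <= enorm (f (z + s *: h) - g) + c * s by near: s.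
rewrite [z + _]addrC [s^-1 * _]mulrC ler_pdivlMr// => wc.
have cw : c * s <= w by have := ler_norm c; nra.
by have : c ^+ 2 >= 0 := sqr_ge0 c; nra.
Unshelve. all: by end_near. Qed.

(** The criterion for metric regularity by normals, in contrapositive form. If the
estimate fails at [(x, y)], let [delta] be the distance of [f x - y] to a
suitable point of [P]; no [z] within [kappa * delta] of [x] has [f z - y] in
[P]. Minimise [enorm (f z - y - p) + kappa^-1 * enorm (z - x)] jointly over [p]
in [P] and [z] in that ball. The value at [x] is [delta], while on the sphere
the second term alone reaches [delta]; so the minimiser has [z] in the open
ball. There [f z - y - p] is nonzero, it is a normal at [p] by minimality in
[p], and minimality in [z] bounds its image under the transposed Jacobian by
[kappa^-1] times its norm. Joint minimisation over a compact set dispenses with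
a variational principle and with the distance function of [P]. *)
Lemma not_metrically_regular_witness (f : 'rV[R]_n -> 'rV[R]_m) kappa x0 :
  0 < kappa -> P (f x0) -> (\forall x \near x0, differentiable f x) ->
  ~ metrically_regular (fun x => [set f x - p | p in P]) kappa x0 0 ->
  forall (U : set 'rV[R]_n) e, nbhs x0 U -> 0 < e ->
  exists z p lam, [/\ U z, P p, enorm (p - f z) < e, enorm lam = 1 &
    normal_to_pieces a b p lam /\ enorm (lam *m ('J f z)^T) <= kappa^-1].
Proof.
move=> kappa0 Pfx0 fdiff notreg U e Ux0 e0.
have [rho rho0 Bd] : exists2 rho, 0 < rho & forall z, enorm (z - x0) < rho ->
    [/\ U z, differentiable f z & enorm (f z - f x0) < e / 4].
  apply/nbhs_enormP; have fx0 : f @ x0 --> f x0.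
    exact: differentiable_continuous (nbhs_singleton fdiff).
  have : \forall z \near x0, enorm (f z - f x0) < e / 4.
    by apply: (fx0 [set y | enorm (y - f x0) < e / 4]); apply: near_enorm; rewrite divr_gt0.
  by move=> fz; apply: filterS3 Ux0 fdiff fz => z; split.
(* [eta] makes [kappa * delta], at most [2 * kappa * eta], less than
   [rho / 2], and [3 * eta] less than [e]. *)
pose eta := Num.min (e / 4) (rho / (8 * kappa)).
have eta0 : 0 < eta by rewrite /eta lt_min !divr_gt0// mulr_gt0.
have etae : eta <= e / 4 by rewrite ge_min lexx.
have etar : kappa * eta <= rho / 8.
  rewrite mulrC -ler_pdivlMr// ge_min.
  by apply/orP; right; rewrite invfM mulrA.
have [d1 d10 Bd1] : exists2 d1, 0 < d1 & forall z, enorm (z - x0) < d1 ->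
    enorm (f z - f x0) < eta /\ enorm (z - x0) < rho / 2.
  apply/nbhs_enormP; have fx0 : f @ x0 --> f x0.
    exact: differentiable_continuous (nbhs_singleton fdiff).
  have fz : \forall z \near x0, enorm (f z - f x0) < eta.
    by apply: (fx0 [set y | enorm (y - f x0) < eta]); exact: near_enorm.
  have zx : \forall z \near x0, enorm (z - x0) < rho / 2.
    by apply: near_enorm; rewrite divr_gt0.
  by apply: filterS2 fz zx => z; split.
apply: contrapT => nex; apply: notreg; split => //.
  by exists (f x0) => //; rewrite subrr.
exists [set z | enorm (z - x0) < d1], [set y | enorm (y - 0) < eta].
split; [exact: near_enorm|exact: near_enorm|].
move=> x y /= xx0; rewrite subr0 => y0; rewrite leNgt; apply/negP => lt_dist.
apply: nex; have [fxx0 xr] := Bd1 x xx0.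
set E := edistance x _ in lt_dist.
have [p1 [Pp1 p1E p1x0]] : exists p1, [/\ P p1,
    ((kappa * enorm (f x - y - p1))%:E < E)%E &
    enorm (f x - y - p1) <= enorm (f x - y - f x0)].
  move: lt_dist; rewrite -lte_pdivlMl// => /ereal_inf_lt[_ [_ [p' Pp' <-] <-]].
  rewrite (_ : y - (f x - p') = - (f x - y - p')); last by rewrite -opprB addrAC.
  rewrite enormN lte_pdivlMl// -EFinM => p'E.
  have [le_x0|/ltW lt_x0] :=
      leP (enorm (f x - y - p')) (enorm (f x - y - f x0)).
    by exists p'.
  exists (f x0); split => //; apply: le_lt_trans p'E.
  by rewrite lee_fin ler_pM2l.
set delta := enorm (f x - y - p1) in p1E p1x0.
have infeasible z : P (f z - y) -> kappa * delta < enorm (z - x).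
  move=> Pz; rewrite -lte_fin enormB; apply: lt_le_trans p1E _.
  apply: ereal_inf_lbound; exists z => //.
  by exists (f z - y) => //; rewrite subKr.
have delta_eta : delta <= 2 * eta.
  apply: le_trans p1x0 _; rewrite addrAC; apply: le_trans (enormD _ _) _.
  by rewrite enormN; lra.
have delta0 : 0 < delta.
  rewrite lt0r enorm_ge0 andbT; apply/eqP => d0.
  have := infeasible x; rewrite subrr enorm0 d0 mulr0 ltxx.
  by move/enorm_eq0/eqP : d0; rewrite subr_eq0 => /eqP-> /(_ Pp1).
(* [P] is cut by a ball only to have a compact set; the bound [2 * e] leaves
   room for all competitors within [e] of the minimiser. *)
pose J (zp : 'rV[R]_n * 'rV[R]_m) :=
  enorm (f zp.1 - y - zp.2) + kappa^-1 * enorm (zp.1 - x).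
pose K := [set z | enorm (z - x) <= kappa * delta] `*`
  (P `&` [set p | enorm (p - f x0) <= 2 * e]).
have Kball z : enorm (z - x) <= kappa * delta -> enorm (z - x0) < rho.
  move=> zx; apply: le_lt_trans (enorm_triangle x _ _) _.
  have : kappa * delta <= kappa * (2 * eta) by rewrite ler_pM2l.
  by lra.
have p1x : enorm (p1 - f x0) <= 2 * e.
  have := enorm_triangle (f x - y) p1 (f x0).
  have := enormD (f x - f x0) (- y); rewrite enormN addrAC.
  by rewrite (enormB p1 (f x - y)) -/delta; lra.
have K0 : K !=set0.
  exists (x, p1); split => //=; rewrite subrr enorm0 mulr_ge0// ltW//.
have Kcompact : compact K.
  apply: compact_setX; first exact: compact_enorm_ball.
  rewrite setIC; apply: compact_closedI; first exact: compact_enorm_ball.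
  exact: closed_union_polyhedra.
have Kcont : {within K, continuous J}.
  apply: continuous_in_subspaceT => -[z p] /set_mem/= [/= /Kball zx _].
  have fz : f @ z --> f z.
    by apply: differentiable_continuous; have [] := Bd z zx.
  have f1 : f zp.1 @[zp --> (z, p)] --> f z.
    exact: (cvg_comp fst f cvg_fst fz).
  apply: (@cvgD _ _ _ (nbhs (z, p))).
    apply: (@cvg_enorm _ _ (nbhs (z, p)) _ _ (fun zp => f zp.1 - y - zp.2)).
    apply: (@cvgB _ _ _ (nbhs (z, p)) _ (fun zp => f zp.1 - y)); last exact: cvg_snd.
    by apply: cvgB => //; exact: cvg_cst.
  apply: cvgMr; apply: (@cvg_enorm _ _ (nbhs (z, p)) _ _ (fun zp => zp.1 - x)).
  by apply: (@cvgB _ _ _ (nbhs (z, p)) _ fst); [exact: cvg_fst|exact: cvg_cst].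
have [[z p] /set_mem/= [/= zx [Pp px0]] Jmin] := compact_EVT_min K0 Kcompact Kcont.
have Jd : J (z, p) <= delta.
  have := Jmin (x, p1); rewrite /J/= subrr enorm0 mulr0 addr0; apply.
  by apply/mem_set; split => //=; rewrite subrr enorm0 mulr_ge0// ltW.
have [Uz fz fzx0] := Bd z (Kball z zx).
set w := f z - y - p.
have w0 : 0 < enorm w.
  rewrite lt0r enorm_ge0 andbT; apply/eqP => /enorm_eq0/eqP.
  rewrite subr_eq0 => /eqP fzy; have := infeasible z; rewrite fzy => /(_ Pp).
  by rewrite ltNge zx.
move: Jd; rewrite /J/= -/w => Jd.
have wd : enorm w <= delta.
  by apply: le_trans Jd; rewrite lerDl mulr_ge0 ?enorm_ge0// invr_ge0 ltW.
have zlt : enorm (z - x) < kappa * delta.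
  by rewrite -ltr_pdivrMl//; lra.
have pfz : enorm (p - f z) <= 3 * eta.
  rewrite enormB (_ : f z - p = w + y); last by rewrite /w addrAC subrK.
  by have := enormD w y; lra.
exists z, p, ((enorm w)^-1 *: w); split => //.
- by lra.
- by rewrite enormZ ger0_norm ?invr_ge0 ?enorm_ge0// mulVf// gt_eqF.
split.
  apply: normal_to_piecesZ; first by rewrite invr_ge0 enorm_ge0.
  apply: (nearest_normal_to_pieces e0) => // p' Pp' pp'.
  have := Jmin (z, p'); rewrite /J/= lerD2r; apply; apply/mem_set; split => //=.
  split => //; have := enorm_triangle p p' (f x0).
  by have := enorm_triangle (f z) p (f x0); lra.
(* The direction of steepest descent of the distance at [z]. *)
set h := - (w *m ('J f z)^T).
have h0 : 0 < 1 + enorm h by rewrite ltr_pwDl ?enorm_ge0.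
have fmin : \forall s \near (0 : R)^'+, enorm (f z - (y + p)) <=
    enorm (f (z + s *: h) - (y + p)) + kappa^-1 * enorm h * s.
  near=> s.
  have s0 : 0 < s by near: s; exact: nbhs_right_gt.
  have sh : s * (1 + enorm h) < kappa * delta - enorm (z - x).
    rewrite -ltr_pdivlMr//; near: s; apply: nbhs_right_lt.
    by rewrite divr_gt0// subr_gt0.
  have zsh : enorm (z + s *: h - x) <= enorm (z - x) + s * enorm h.
    by rewrite addrAC; apply: le_trans (enormD _ _) _; rewrite enormZ gtr0_norm.
  have : J (z, p) <= J (z + s *: h, p).
    apply: Jmin; apply/mem_set; split => //=.
    by have := enorm_ge0 h; lra.
  rewrite /J/= !opprD !addrA => Jle.
  have : kappa^-1 * enorm (z + s *: h - x) <= kappa^-1 * (enorm (z - x) + s * enorm h).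
    by rewrite ler_pM2l ?invr_gt0.
  by lra.
have := directional_slope _ fz fmin; rewrite opprD addrA -/w => /(_ w0).
rewrite dotv_mulmx dotvNr -/(dotv _ _) -sqr_enorm -(enormN (w *m _)) -/h => hw.
rewrite -scalemxAl enormZ ger0_norm ?invr_ge0 ?enorm_ge0// -(enormN (w *m _)) -/h.
rewrite ler_pdivrMl//.
have := enorm_ge0 h; rewrite le_eqVlt => /predU1P[<-|h_gt0].
  by rewrite mulr_ge0 ?invr_ge0 ?ltW.
by rewrite -(ler_pM2r h_gt0); move: hw; clear; lra.
Unshelve. all: by end_near. Qed.

End RegularityCriterion.

(** * Taylor expansions of vector-valued maps *)

Section TaylorVectorMaps.
Context {R : realType}.

(** A differential is a local notion. It is needed because the gradient is given by
the Jacobian only where the map is differentiable, that is, only near [x]. *)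
Lemma near_eq_diff (V W : normedModType R) (f g : V -> W) x :
  (\forall y \near x, f y = g y) -> differentiable g x ->
  'd f x = 'd g x :> (V -> W).
Proof.
move=> fg dg; apply: diff_unique; first exact: diff_continuous.
have fgx := nbhs_singleton fg.
apply/eqaddoP => e e0; have /eqaddoP/(_ e e0) := diff_locally dg.
have : \forall h \near (0 : V), f (h + x) = g (h + x).
  have shx : shift x @ (0 : V) --> x.
    rewrite -[X in _ --> X]add0r; apply: (@cvgD _ _ _ (nbhs 0) _ id (cst x)).
      exact: cvg_id.
    exact: cvg_cst.
  exact: (shx [set y | f y = g y]).
apply: filterS2 => h fgh; rewrite /GRing.opp/= /GRing.add/=.
by rewrite fgh fgx.
Qed.

(** The gradient of [dotv lam \o f] is the Jacobian of [f] composed with the linear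
map that sends a matrix to its transpose multiplied by [lam]. *)
Lemma quadform_hessian n m (f : 'rV[R]_n -> 'rV[R]_m) lam x h :
  (\forall y \near x, differentiable f y) -> differentiable (jacobian f) x ->
  quadform (hessian (fun y => dotv lam (f y)) x) h =
  dotv lam (h *m 'D_h (jacobian f) x).
Proof.
move=> fx Jx; pose T := trmx : 'M[R]_(n, m) -> 'M[R]_(m, n).
pose L := mulmx lam : 'M[R]_(m, n) -> 'rV[R]_n.
have Tc : continuous T.
  by move=> N; apply: (@cvg_trmx _ _ (nbhs N) _ _ _ id); exact: cvg_id.
have Lc : continuous L.
  move=> N; apply: (@cvg_mulmx _ _ (nbhs N) _ _ _ _ (cst lam) id).
    exact: cvg_cst.
  exact: cvg_id.
have Tx M : differentiable T M by exact: linear_differentiable.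
have Lx M : differentiable L M by exact: linear_differentiable.
have gradE : \forall y \near x,
    gradient (fun y => dotv lam (f y)) y = (L \o (T \o jacobian f)) y.
  apply: filterS fx => y fy; apply/rowP => j; rewrite !mxE.
  have fj := differentiable_is_derive (delta_mx 0 j) fy.
  rewrite (@derive_val _ _ _ _ _ _ _ (is_derive_dotv lam fj)) dotv_mulmx.
  by rewrite dotvC dotv_delta mxE.
have dTJ : differentiable (T \o jacobian f) x by exact: differentiable_comp.
have dLTJ : differentiable (L \o (T \o jacobian f)) x by exact: differentiable_comp.
rewrite /quadform /hessian /jacobian mul_rV_lin1/= (near_eq_diff gradE dLTJ).
rewrite diff_comp// /= diff_comp//= -/(jacobian f) diff_lin//.
rewrite diff_lin//.
by rewrite /L /T deriveE// dotv_mulmx.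
Qed.

Lemma quadform_hessian_sum n m (f : 'rV[R]_n -> 'rV[R]_m) lam x h :
  (\forall y \near x, differentiable f y) -> differentiable (jacobian f) x ->
  quadform (hessian (fun y => dotv lam (f y)) x) h =
  \sum_i lam 0 i * quadform (hessian (fun y => f y 0 i) x) h.
Proof.
move=> fx Jx; transitivity (dotv lam (h *m 'D_h (jacobian f) x)).
  exact: quadform_hessian.
apply: eq_bigr => i _; congr (_ * _).
have := quadform_hessian (delta_mx 0 i) h fx Jx; rewrite dotv_delta => <-.
congr (quadform (hessian _ x) h).
by apply/funext => y; rewrite dotv_delta.
Qed.

(** A vector-valued map has no mean value equality, but each of its scalar
projections has one, with a point of its own. *)
Lemma dotv_mean_value n m (f : 'rV[R]_n -> 'rV[R]_m) x h mu :
  (forall s : R, 0 <= s <= 1 -> differentiable f (x + s *: h)) ->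
  exists2 s : R, 0 <= s <= 1 &
    dotv mu (f (x + h) - f x) = dotv mu (h *m 'J f (x + s *: h)).
Proof.
move=> fx; have [s s01|s s01 fs] := @mean_value_unit _
    (fun s => dotv mu (f (x + s *: h)))
    (fun s => dotv mu (h *m 'J f (x + s *: h))).
  have := differentiable_is_derive h (fx s s01) => /(is_derive_dotv mu).
  exact: (@is_derive_line _ _ _ (fun y => dotv mu (f y))).
by exists s => //; rewrite dotvBr -fs scale1r scale0r addr0.
Qed.

Lemma dotv_taylor2 n m (f : 'rV[R]_n -> 'rV[R]_m) x h mu :
  (forall s : R, 0 <= s <= 1 -> \forall y \near x + s *: h, differentiable f y) ->
  (forall s : R, 0 <= s <= 1 -> differentiable (jacobian f) (x + s *: h)) ->
  exists2 s : R, 0 <= s <= 1 &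
    dotv mu (f (x + h) - f x) = dotv mu (h *m 'J f x) +
      quadform (hessian (fun y => dotv mu (f y)) (x + s *: h)) h / 2.
Proof.
move=> fx Jx; have [s s01|s s01|s s01 fs] := @taylor2_unit _
    (fun s => dotv mu (f (x + s *: h)))
    (fun s => dotv mu (h *m 'J f (x + s *: h)))
    (fun s => dotv mu (h *m 'D_h (jacobian f) (x + s *: h))).
- have := differentiable_is_derive h (nbhs_singleton (fx s s01)) => /(is_derive_dotv mu).
  exact: (@is_derive_line _ _ _ (fun y => dotv mu (f y))).
- apply: (@is_derive_line _ _ _ (fun y => dotv mu (h *m 'J f y))).
  apply: is_derive_dotv; apply/is_deriveP.
  under eq_fun do rewrite -mulmxBr scalemxAr.
  apply: (@cvg_mulmx _ _ _ _ _ _ _ (cst h)); first exact: cvg_cst.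
  exact: diff_derivable (Jx s s01).
- exists s => //; have Q := quadform_hessian mu h (fx s s01) (Jx s s01).
  by rewrite dotvBr; move: fs; rewrite scale1r scale0r addr0 => ->; congr (_ + _ / 2).
Qed.

End TaylorVectorMaps.

(** * Convergent sequences *)

Section Sequences.
Context {R : realType}.

Lemma cvg_of_dist_le {T} {F : set_system T} {FF : Filter F} (f e : T -> R) c l :
  (\forall k \near F, `|f k - l| <= c * e k) -> e @ F --> (0 : R) -> f @ F --> l.
Proof.
move=> fle e0; apply/cvgrPdist_lt => eps eps0.
have : (fun k => c * e k) @ F --> (0 : R).
  by rewrite -(mulr0 c); exact: cvgMr.
move=> /cvgrPdist_lt/(_ eps eps0); apply: filterS2 fle => k fk.
by rewrite sub0r normrN distrC => /(le_lt_trans (ler_norm _)); exact: le_lt_trans.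
Qed.

Lemma cvg_eq_ends {T} {F : set_system T} {FF : Filter F} (f g : T -> R) (x y : R) :
  f =1 g -> x = y -> g @ F --> y -> f @ F --> x.
Proof. by move=> /funext-> ->. Qed.

Lemma cvg_unit_neq0 d (v_ : nat -> 'rV[R]_d) (v : 'rV[R]_d) :
  v_ @ \oo --> v -> (forall j, enorm (v_ j) = 1) -> v != 0.
Proof.
move=> v_cvg v1; apply/eqP => v0; have := cvg_enorm v_cvg.
rewrite (_ : (fun j => _) = cst 1); last by apply/funext => j; exact: v1.
move=> one_cvg.
have : enorm v = 1.
  by apply: (cvg_unique (@norm_hausdorff _ _) (one_cvg _)); exact: cvg_cst.
by rewrite v0 enorm0 => /esym/eqP; rewrite oner_eq0.
Qed.

(** The indices need not increase: [k <= sigma k] suffices to inherit the limits of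
the original sequence. *)
Lemma compact_subsequence (V : pseudoMetricType R) (K : set V) (s : nat -> V) :
  compact K -> (forall k, K (s k)) ->
  exists v (sigma : nat -> nat),
    [/\ K v, forall k, (k <= sigma k)%N & s \o sigma @ \oo --> v].
Proof.
move=> cK Ks; have [|v [Kv clv]] := cK (s @ \oo) _.
  by exists 0%N => // k _; exact: Ks.
have /choice[sigma sigmaP] : forall k : nat,
    exists j, (k <= j)%N /\ ball v (k.+1%:R^-1) (s j).
  move=> k; have tail : (s @ \oo) [set s j | j in [set j | (k <= j)%N]].
    by exists k => // j kj; exists j.
  have vk : nbhs v (ball v (k.+1%:R^-1 : R)) by apply: nbhsx_ballx; rewrite invr_gt0.
  by have [_ [[j kj <-] vj]] := clv _ _ tail vk; exists j.
exists v, sigma; split => // [k|]; first by have [] := sigmaP k.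
apply/cvg_ballP => eps eps0.
near=> k; apply: (@le_ball _ _ _ k.+1%:R^-1); last by have [] := sigmaP k.
by apply/ltW; near: k; exact: (near_infty_natSinv_lt (PosNum eps0)).
Unshelve. all: by end_near. Qed.

End Sequences.

(** * Nearly singular points *)

Section Failure.
Context {R : realType} {n m : nat} {Omega : topologicalType}.
Variable q : 'rV[R]_n -> Omega -> 'rV[R]_m.
Context {r : nat} {k : 'I_r -> nat}.
Variables (a : forall i : 'I_r, 'I_(k i) -> 'rV[R]_m).
Variables (b : forall i : 'I_r, 'I_(k i) -> R).
Let P := \bigcup_(i in [set: 'I_r]) convex_polyhedron (@a i) (@b i).
Variables (xb : 'rV[R]_n) (wb : Omega).

(** With the error, all the information on the parameter [w] that the proof
retains. The space of parameters carries no countability assumption, so no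
sequence of parameters can be made to converge; the numbers below can. *)
Definition derivatives_close e x w : Prop :=
  [/\ \forall y \near x, differentiable (q^~ w) y,
      differentiable ((Dx q)^~ w) x,
      forall i j, `|Dx q x w i j - Dx q xb wb i j| <= e &
      forall l i j, `|hess_comp q l x w i j - hess_comp q l xb wb i j| <= e].

(** What failure of the property leaves at accuracy [e]. The distance of
[p] to [q z w] is of second order in [enorm (z - xb)] because it enters a second
order expansion. Derivatives are controlled on a whole ball, which contains the
segment from [xb] to [z], as mean values require. *)
Definition nearly_singular l e w z p lam : Prop :=
  let t := enorm (z - xb) in
  [/\ 0 < t <= e, err q xb wb l w <= e * t,
      forall x, enorm (x - xb) <= t -> derivatives_close e x w,
      P p /\ enorm (p - q z w) <= e * t ^+ 2 &
      [/\ normal_to_pieces a b p lam, enorm lam = 1 &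
          enorm (lam *m (Dx q z w)^T) <= e]].

Lemma near_derivatives_close e : 0 < e -> smoothness_assumption q xb wb ->
  exists (rho : R) (W : set Omega), [/\ 0 < rho, nbhs wb W &
    forall x w, enorm (x - xb) < rho -> W w -> derivatives_close e x w].
Proof.
move=> e0 [U0 [W0 [/nbhs_enormP[r0 r00 U0r] W0wb qdiff [_ Dc Hc] _]]].
have closeD : \forall z \near (xb, wb), forall i j,
    `|Dx q z.1 z.2 i j - Dx q xb wb i j| <= e.
  exact: (cvg_mx_dist_le e0 Dc).
have closeH : \forall z \near (xb, wb), forall l i j,
    `|hess_comp q l z.1 z.2 i j - hess_comp q l xb wb i j| <= e.
  apply: (@filter_forall _ _ _ (nbhs (xb, wb))) => l.
  exact: (cvg_mx_dist_le e0 (Hc l)).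
have [[U W] /= [/nbhs_enormP[r1 r10 Ur1] Wwb] UW] := filterI closeD closeH.
exists (Num.min r0 r1), (W `&` W0); split.
- by rewrite lt_min r00.
- exact: filterI.
move=> x w; rewrite lt_min => /andP[xr0 xr1] [Ww W0w].
have [closeDx closeHx] := UW (x, w) (conj (Ur1 _ xr1) Ww); split => //.
- have : nbhs x [set y | enorm (y - xb) < r0].
    apply/nbhs_enormP; exists (r0 - enorm (x - xb)); first by rewrite subr_gt0.
    by move=> y yx /=; apply: le_lt_trans (enorm_triangle x _ _) _; lra.
  by apply: filterS => y yr0; have [] := qdiff y w (U0r _ yr0) W0w.
- by have [] := qdiff x w (U0r _ xr0) W0w.
Qed.

Lemma err_ge0 l w : 0 <= err q xb wb l w.
Proof. by rewrite addr_ge0 ?opnorm_ge0 ?powR_ge0. Qed.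

(** A point [x] where regularity fails is feasible, but the normal found nearby sits
at another pair [z], [p]. Both can be taken as close to [x] and [q x w] as
desired, so the strict inequalities satisfied by [x] pass to [z]. *)
Lemma not_property_R_nearly_singular l e : smoothness_assumption q xb wb ->
  ~ property_R q P xb wb l -> 0 < e ->
  exists w z p lam, nearly_singular l e w z p lam.
Proof.
move=> smooth notR e0.
have [rho [W [rho0 Wwb close]]] := near_derivatives_close e0 smooth.
pose d := Num.min rho e; have d0 : 0 < d by rewrite lt_min rho0.
apply: contrapT => none; apply: notR.
exists [set x | enorm (x - xb) < d], W, e^-1, e^-1.
split; rewrite ?invr_gt0//; first exact: near_enorm.
move=> w x Ww [Fx /= xd] xerr; apply: contrapT => notreg; apply: none.
set t := enorm (x - xb) in xd xerr.
have t0 : 0 < t.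
  by apply: le_lt_trans xerr; rewrite mulr_ge0 ?err_ge0// invr_ge0 ltW.
pose U := [set z | [/\ enorm (z - xb) < d, e^-1 * err q xb wb l w < enorm (z - xb) &
  t / 2 < enorm (z - xb)]].
have xU : nbhs x U.
  have cont : (fun z => enorm (z - xb)) @ x --> t.
    apply: (@cvg_enorm _ _ (nbhs x) _ _ (fun z => z - xb)).
    by apply: (@cvgB _ _ _ (nbhs x) _ id (cst xb)); [exact: cvg_id|exact: cvg_cst].
  have t2 : t / 2 < t by lra.
  apply: filterS3 (cvgr_lt _ cont _ xd) (cvgr_gt _ cont _ xerr) (cvgr_gt _ cont _ t2).
  by move=> z; split.
have rhod z : enorm (z - xb) < d -> enorm (z - xb) < rho.
  by move/lt_le_trans; apply; rewrite ge_min lexx.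
have qdiff : \forall y \near x, differentiable (q^~ w) y.
  by have [] := close x w (rhod _ xd) Ww.
have et0 : 0 < e * (t / 2) ^+ 2 by rewrite mulr_gt0// exprn_gt0// divr_gt0.
have einv : 0 < e^-1 by rewrite invr_gt0.
have [z [p [lam [[zd zerr zt] Pp pz lam1 [lamN lamD]]]]] :=
  not_metrically_regular_witness einv Fx qdiff notreg xU et0.
exists w, z, p, lam; split => //.
- have -> : 0 < enorm (z - xb) by apply: lt_trans zt; rewrite divr_gt0.
  by rewrite /= (le_trans (ltW zd))// ge_min lexx orbT.
- by rewrite -ler_pdivrMl// ltW.
- by move=> y yz; apply: close => //; apply: rhod; exact: le_lt_trans zd.
- split => //; apply: le_trans (ltW pz) _; rewrite ler_pM2l//.
  rewrite ler_pXn2r ?nnegrE ?enorm_ge0 ?(ltW zt)//.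
  by rewrite divr_ge0// ltW.
- by rewrite invrK in lamD; split.
Qed.

End Failure.

(** * The blow-up limit *)

Section LimitPassage.
Context {R : realType} {n m : nat} {Omega : topologicalType}.
Context (q : 'rV[R]_n -> Omega -> 'rV[R]_m).
Context {r : nat} {k : 'I_r -> nat}.
Context (a : forall i : 'I_r, 'I_(k i) -> 'rV[R]_m).
Context (b : forall i : 'I_r, 'I_(k i) -> R).
Let P := \bigcup_(i in [set: 'I_r]) convex_polyhedron (@a i) (@b i).
Context (xb : 'rV[R]_n) (wb : Omega) (l : nat).
Context (e_ : nat -> R) (w_ : nat -> Omega) (z_ : nat -> 'rV[R]_n).
Context (p_ lam_ : nat -> 'rV[R]_m) (u : 'rV[R]_n) (lam : 'rV[R]_m).
Let t_ j := enorm (z_ j - xb).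
Let h_ j := (t_ j)^-1 *: (z_ j - xb).
Context (e1 : forall j, e_ j <= 1) (e_cvg0 : e_ @ \oo --> (0 : R)).
Context (sing : forall j,
  nearly_singular q a b xb wb l (e_ j) (w_ j) (z_ j) (p_ j) (lam_ j)).
Context (h_cvg : h_ @ \oo --> u) (lam_cvg : lam_ @ \oo --> lam).

Let t_gt0 j : 0 < t_ j. Proof. by have [/andP[]] := sing j. Qed.
Let t_le j : t_ j <= e_ j. Proof. by have [/andP[]] := sing j. Qed.
Let t_le1 j : t_ j <= 1. Proof. exact: le_trans (t_le j) (e1 j). Qed.
Let e_gt0 j : 0 < e_ j. Proof. exact: lt_le_trans (t_gt0 j) (t_le j). Qed.

Let hE j : t_ j *: h_ j = z_ j - xb.
Proof. by rewrite scalerA divff ?scale1r// gt_eqF. Qed.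

Let enorm_h j : enorm (h_ j) = 1.
Proof. by rewrite enormZ gtr0_norm ?invr_gt0// mulVf// gt_eqF. Qed.

Lemma t_decreases_to0 : decreases_to0 t_.
Proof.
split=> //; apply: (@cvg_of_dist_le _ _ _ _ _ e_ 1) => //.
by apply: nearW => j; rewrite subr0 mul1r gtr0_norm.
Qed.

Lemma limit_direction_neq0 : u != 0.
Proof. exact: cvg_unit_neq0 h_cvg enorm_h. Qed.

Lemma limit_multiplier_neq0 : lam != 0.
Proof. by apply: cvg_unit_neq0 lam_cvg _ => j; have [_ _ _ _ []] := sing j. Qed.

Lemma derivatives_close_segment j s : 0 <= s <= 1 ->
  derivatives_close q xb wb (e_ j) (xb + s *: (z_ j - xb)) (w_ j).
Proof.
move=> s01; have [_ _ close _ _] := sing j; apply: close.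
rewrite [_ + _ - xb]addrC addKr enormZ ger0_norm; last by case/andP: s01.
by rewrite ler_piMl ?enorm_ge0//; case/andP: s01.
Qed.

Lemma multiplier_in_kernel : lam *m (Dx q xb wb)^T = 0.
Proof.
have D_cvg : (fun j => Dx q (z_ j) (w_ j)) @ \oo --> Dx q xb wb.
  apply/cvg_mxP => i i'; apply: (@cvg_of_dist_le _ _ _ _ _ e_ 1) => //.
  apply: nearW => j; rewrite mul1r.
  have [_ _ + _] := @derivatives_close_segment j 1 (introT andP (conj ler01 (lexx 1))).
  by rewrite scale1r addrC subrK; exact.
have prod_cvg : (fun j => lam_ j *m (Dx q (z_ j) (w_ j))^T) @ \oo -->
    lam *m (Dx q xb wb)^T.
  by apply: cvg_mulmx lam_cvg _; exact: cvg_trmx.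
apply: (cvg_unique (@norm_hausdorff _ _) prod_cvg); apply/cvg_enorm0P.
apply: (@cvg_of_dist_le _ _ _ _ _ e_ 1) => //; apply: nearW => j.
rewrite !subr0 mul1r ger0_norm ?enorm_ge0//.
by have [_ _ _ _ []] := sing j.
Qed.

Context (q_close : forall j, enorm (q xb (w_ j) - q xb wb) <= e_ j * t_ j).

(** Write [p_ j - q xb wb] as the sum of [p_ j - q (z_ j) (w_ j)], the increment of
[q^~ (w_ j)] from [xb] to [z_ j], and [q xb (w_ j) - q xb wb]. After division by
[t_ j] the first and the last vanish in the limit, and the middle one is
[h_ j] times a Jacobian that tends to [Dx q xb wb]. *)
Lemma scaled_image_cvg :
  (fun j => (t_ j)^-1 *: (p_ j - q xb wb)) @ \oo --> u *m Dx q xb wb.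
Proof.
have hD_cvg : (fun j => h_ j *m Dx q xb wb) @ \oo --> u *m Dx q xb wb.
  by apply: cvg_mulmx => //; exact: cvg_cst.
apply/cvg_mxP => i0 i; rewrite ord1.
have /cvg_mxP/(_ 0 i) hDi := hD_cvg.
suff diff0 : (fun j => ((t_ j)^-1 *: (p_ j - q xb wb)) 0 i -
    (h_ j *m Dx q xb wb) 0 i) @ \oo --> (0 : R).
  rewrite -[X in _ --> X]add0r.
  have -> : (fun j => ((t_ j)^-1 *: (p_ j - q xb wb)) 0 i) =
      (fun j => (((t_ j)^-1 *: (p_ j - q xb wb)) 0 i - (h_ j *m Dx q xb wb) 0 i)
        + (h_ j *m Dx q xb wb) 0 i) by apply/funext => j; rewrite subrK.
  exact: cvgD diff0 hDi.
apply: (@cvg_of_dist_le _ _ _ _ _ e_ (2 + n%:R)) => //; apply: nearW => j.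
have t0 := t_gt0 j.
have pq : `|(p_ j - q (z_ j) (w_ j)) 0 i| <= e_ j * t_ j.
  apply: le_trans (coord_le_enorm _ _) _; have [_ _ _ [_ +] _] := sing j.
  by move/le_trans; apply; rewrite ler_pM2l// expr2 ler_piMl ?enorm_ge0//; exact: t_le1.
have qq : `|(q xb (w_ j) - q xb wb) 0 i| <= e_ j * t_ j.
  exact: le_trans (coord_le_enorm _ _) (q_close j).
have [s s01] := @dotv_mean_value _ _ _ (q^~ (w_ j)) xb (z_ j - xb) (delta_mx 0 i)
  (fun s s01 => let: And4 c _ _ _ := derivatives_close_segment j s01 in nbhs_singleton c).
rewrite !dotv_delta [xb + (_ - xb)]addrC subrK => mv.
have [_ _ + _] := derivatives_close_segment j s01.
set x := xb + _; rewrite -/(Dx q x (w_ j)) in mv * => closeD.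
have hDD : `|(h_ j *m Dx q x (w_ j)) 0 i - (h_ j *m Dx q xb wb) 0 i| <= n%:R * e_ j.
  by apply: mulmx_coord_dist => //; rewrite enorm_h.
have hDx : (h_ j *m Dx q x (w_ j)) 0 i =
    (t_ j)^-1 * (q (z_ j) (w_ j) - q xb (w_ j)) 0 i.
  by rewrite mv -scalemxAl [LHS]mxE.
have -> : ((t_ j)^-1 *: (p_ j - q xb wb)) 0 i =
    (t_ j)^-1 * ((p_ j - q (z_ j) (w_ j)) 0 i + (q xb (w_ j) - q xb wb) 0 i) +
    (h_ j *m Dx q x (w_ j)) 0 i.
  rewrite [X in _ = _ + X]hDx -mulrDr [LHS]mxE; congr (_ * _).
  by rewrite !mxE; ring.
rewrite subr0 -addrA; apply: le_trans (ler_normD _ _) _; rewrite mulrDl.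
apply: lerD => //.
rewrite normrM gtr0_norm ?invr_gt0// ler_pdivrMl//.
by apply: le_trans (ler_normD _ _) _; lra.
Qed.

Let pE j : q xb wb + t_ j *: ((t_ j)^-1 *: (p_ j - q xb wb)) = p_ j.
Proof. by rewrite scalerA divff ?scale1r ?gt_eqF// addrC subrK. Qed.

Lemma limit_in_linearized_tangent_cone : linearized_tangent_cone q P wb xb u.
Proof.
exists (fun j => (t_ j)^-1 *: (p_ j - q xb wb)), t_.
split; [exact: scaled_image_cvg|exact: t_decreases_to0|].
by move=> j; rewrite pE; have [_ _ _ []] := sing j.
Qed.

Lemma limit_in_directional_normal_cone :
  directional_normal_cone (q xb wb) P (u *m Dx q xb wb) lam.
Proof.
exists t_, (fun j => (t_ j)^-1 *: (p_ j - q xb wb)), lam_.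
split; [exact: t_decreases_to0|exact: scaled_image_cvg|exact: lam_cvg|].
move=> j; rewrite pE; have [_ _ _ [Pp _] [lamN _ _]] := sing j.
exact: normal_to_pieces_regular.
Qed.

Context (q_close2 : forall j, enorm (q xb (w_ j) - q xb wb) <= e_ j * t_ j ^+ 2).

Lemma image_cvg : p_ @ \oo --> q xb wb.
Proof.
have : (fun j => q xb wb + t_ j *: ((t_ j)^-1 *: (p_ j - q xb wb))) @ \oo -->
    q xb wb + 0 *: (u *m Dx q xb wb).
  apply: cvgD; first exact: cvg_cst.
  by apply: cvgZ; [exact: t_decreases_to0.2|exact: scaled_image_cvg].
rewrite scale0r addr0 (_ : (fun j => _) = p_)//.
by apply/funext => j; exact: pE.
Qed.

(** Here polyhedrality enters. The normals [lam_ j] would be of no use in a second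
order expansion, since the transposed Jacobian sends them to a vector that is
small but not of the order of [t_ j]. The limit [lam] is annihilated by it, and by
finiteness of the family of cones it is itself a normal at [p_ j]. *)
Lemma limit_multiplier_orth : \forall j \near \oo,
  dotv lam (p_ j - q xb wb) = 0.
Proof.
have lamN : \forall j \near \oo, normal_to_pieces a b (p_ j) lam.
  have sub : \forall j \near \oo, forall p,
      normal_to_pieces a b p (lam_ j) -> normal_to_pieces a b p lam.
    exact: (lam_cvg (near_normal_to_pieces_sub a b lam)).
  by apply: filterS sub => j; apply; have [_ _ _ _ []] := sing j.
have orth := image_cvg (near_normal_to_pieces_orth a b (q xb wb)).
apply: filterS2 lamN orth => j lamNj; apply => //.
by have [_ _ _ []] := sing j.
Qed.

Context (diff_b : \forall y \near xb, differentiable (q^~ wb) y).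
Context (diffD_b : differentiable ((Dx q)^~ wb) xb).

Lemma hess_form_cvg (x_ : nat -> 'rV[R]_n) :
  (forall j, derivatives_close q xb wb (e_ j) (x_ j) (w_ j)) ->
  (fun j => quadform (hess_x q lam (x_ j) (w_ j)) (h_ j)) @ \oo -->
    quadform (hess_x q lam xb wb) u.
Proof.
move=> close.
apply: (@cvg_eq_ends _ _ _ _ _
    (fun j => \sum_i lam 0 i * quadform (hess_comp q i (x_ j) (w_ j)) (h_ j))
    _ (\sum_i lam 0 i * quadform (hess_comp q i xb wb) u)).
- by move=> j; have [dq dD _ _] := close j; exact: (quadform_hessian_sum lam (h_ j) dq dD).
- exact: (quadform_hessian_sum lam u diff_b diffD_b).
apply: cvg_sumR => i; apply: cvgMr; apply: cvg_dotv => //.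
apply: cvg_mulmx => //; apply/cvg_mxP => i' j'.
apply: (@cvg_of_dist_le _ _ _ _ _ e_ 1) => //; apply: nearW => j.
by rewrite mul1r; have [_ _ _] := close j; exact.
Qed.

(** Expand [dotv lam (p_ j - q xb wb)], which is eventually zero, to second order. The
first order term is [dotv lam] of [z_ j - xb] times the Jacobian at [(xb, w_ j)],
and as [lam] kills the Jacobian at [(xb, wb)] it is bounded by the operator norm in
the error, hence by [e_ j * t_ j] times [t_ j]. All terms but the quadratic one
are thus [e_ j * t_ j ^+ 2] up to a constant, and division by [t_ j ^+ 2] leaves
the quadratic form. *)
Lemma limit_quadform_eq0 : quadform (hess_x q lam xb wb) u = 0.
Proof.
have /choice[s_ sP] : forall j, exists s : R, 0 <= s <= 1 /\
    dotv lam (q (z_ j) (w_ j) - q xb (w_ j)) =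
    dotv lam ((z_ j - xb) *m Dx q xb (w_ j)) +
    quadform (hess_x q lam (xb + s *: (z_ j - xb)) (w_ j)) (z_ j - xb) / 2.
  move=> j.
  have [||s s01] := @dotv_taylor2 _ _ _ (q^~ (w_ j)) xb (z_ j - xb) lam.
  - by move=> s /(derivatives_close_segment j)[].
  - by move=> s /(derivatives_close_segment j)[].
  by rewrite [xb + (_ - xb)]addrC subrK => mv; exists s.
have form_cvg : (fun j => quadform
    (hess_x q lam (xb + s_ j *: (z_ j - xb)) (w_ j)) (h_ j)) @ \oo -->
    quadform (hess_x q lam xb wb) u.
  by apply: hess_form_cvg => j; apply: derivatives_close_segment; have [] := sP j.
apply: (cvg_unique (@norm_hausdorff _ _) form_cvg).
apply: (@cvg_of_dist_le _ _ _ _ _ e_ (6 * enorm lam)) => //.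
apply: filterS limit_multiplier_orth => j orth; have [s01 tayl] := sP j.
have t0 := t_gt0 j; have et := e_gt0 j; have lam0 := enorm_ge0 lam.
move: tayl; set Q := quadform _ (z_ j - xb).
have -> : Q = t_ j ^+ 2 * quadform (hess_x q lam (xb + s_ j *: (z_ j - xb)) (w_ j)) (h_ j).
  by rewrite /Q -hE /quadform -scalemxAl dotvZl dotvZr mulrA.
set Qh := quadform _ (h_ j) => tayl; rewrite subr0.
have pq : `|dotv lam (p_ j - q (z_ j) (w_ j))| <= enorm lam * (e_ j * t_ j ^+ 2).
  apply: le_trans (normr_dotv _ _) _; apply: ler_wpM2l => //.
  by have [_ _ _ []] := sing j.
have qq : `|dotv lam (q xb (w_ j) - q xb wb)| <= enorm lam * (e_ j * t_ j ^+ 2).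
  by apply: le_trans (normr_dotv _ _) _; apply: ler_wpM2l.
have D1 : `|dotv lam ((z_ j - xb) *m Dx q xb (w_ j))| <= enorm lam * (e_ j * t_ j ^+ 2).
  have -> : dotv lam ((z_ j - xb) *m Dx q xb (w_ j)) =
      t_ j * dotv lam (h_ j *m (Dx q xb (w_ j) - Dx q xb wb)).
    rewrite mulmxBr dotvBr [X in _ * (_ - X)]dotv_mulmx multiplier_in_kernel.
    by rewrite (dotvC 0) dotv0 subr0 -dotvZr scalemxAl hE.
  have -> : enorm lam * (e_ j * t_ j ^+ 2) = t_ j * (enorm lam * (e_ j * t_ j)) by ring.
  rewrite normrM gtr0_norm// ler_pM2l//; apply: le_trans (normr_dotv _ _) _.
  apply: ler_wpM2l => //; apply: le_trans (opnorm_bound _ _) _; first by rewrite enorm_h.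
  have [_ + _ _ _] := sing j; apply: le_trans.
  by rewrite /err lerDl powR_ge0.
have split0 : dotv lam (p_ j - q xb wb) = dotv lam (p_ j - q (z_ j) (w_ j)) +
    dotv lam (q (z_ j) (w_ j) - q xb (w_ j)) + dotv lam (q xb (w_ j) - q xb wb).
  by rewrite !dotvBr; ring.
have t2 : 0 < t_ j ^+ 2 by rewrite exprn_gt0.
rewrite -(ler_pM2l t2) -{1}(gtr0_norm t2) -normrM.
move: split0 pq qq D1; rewrite orth tayl; move: (_ * Qh) => X.
move: (dotv lam _) (dotv lam _) (dotv lam _) => A B C.
rewrite !ler_norml; move: (enorm lam) => L; move: (t_ j ^+ 2) (e_ j) => T E.
lra.
Qed.

End LimitPassage.

(** * Proof of the theorem *)

Section Conclusion.
Context {R : realType} {n m : nat} {Omega : topologicalType}.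
Context (q : 'rV[R]_n -> Omega -> 'rV[R]_m).
Context {r : nat} {k : 'I_r -> nat}.
Context (a : forall i : 'I_r, 'I_(k i) -> 'rV[R]_m).
Context (b : forall i : 'I_r, 'I_(k i) -> R).
Let P := \bigcup_(i in [set: 'I_r]) convex_polyhedron (@a i) (@b i).
Context (xb : 'rV[R]_n) (wb : Omega).

(** The accuracies are [1 / (j + 1)]; the unit directions and the unit normals live
in a product of two compact balls. *)
Lemma not_property_R_sequences l : smoothness_assumption q xb wb ->
  ~ property_R q P xb wb l ->
  exists (e_ : nat -> R) (w_ : nat -> Omega) (z_ : nat -> 'rV[R]_n)
    (p_ lam_ : nat -> 'rV[R]_m) (u : 'rV[R]_n) (lam : 'rV[R]_m),
    [/\ forall j, e_ j <= 1, e_ @ \oo --> (0 : R),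
      forall j, nearly_singular q a b xb wb l (e_ j) (w_ j) (z_ j) (p_ j) (lam_ j),
      (fun j => (enorm (z_ j - xb))^-1 *: (z_ j - xb)) @ \oo --> u &
      lam_ @ \oo --> lam].
Proof.
move=> smooth notR.
have : forall j : nat, exists c : Omega * 'rV[R]_n * 'rV[R]_m * 'rV[R]_m,
    nearly_singular q a b xb wb l (harmonic j) c.1.1.1 c.1.1.2 c.1.2 c.2.
  move=> j; have [w [z [p [lam ns]]]] :=
    not_property_R_nearly_singular smooth notR (harmonic_gt0 j).
  by exists (w, z, p, lam).
move=> /choice[c cP].
pose h j := (enorm ((c j).1.1.2 - xb))^-1 *: ((c j).1.1.2 - xb).
pose K := [set v : 'rV[R]_n | enorm (v - 0) <= 1] `*`
  [set v : 'rV[R]_m | enorm (v - 0) <= 1].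
have cK : compact K by apply: compact_setX; exact: compact_enorm_ball.
have Kc j : K (h j, (c j).2).
  have [/andP[t0 _] _ _ _ [_ lam1 _]] := cP j.
  split; rewrite /= subr0 ?lam1//.
  by rewrite enormZ gtr0_norm ?invr_gt0// mulVf// gt_eqF.
have [[u lam] [sigma [_ sigmaj uv]]] := compact_subsequence cK Kc.
exists (harmonic \o sigma), (fun j => (c (sigma j)).1.1.1),
  (fun j => (c (sigma j)).1.1.2), (fun j => (c (sigma j)).1.2),
  (fun j => (c (sigma j)).2), u, lam; split.
- by move=> j /=; rewrite invf_le1// ler1n.
- apply: (@cvg_of_dist_le _ _ _ _ _ harmonic 1); last exact: cvg_harmonic.
  apply: nearW => j; rewrite subr0 mul1r ger0_norm ?harmonic_ge0//.
  by rewrite /= lef_pV2 ?posrE// ler_nat ltnS.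
- by move=> j; exact: cP.
- exact: (cvg_comp _ fst uv cvg_fst).
- exact: (cvg_comp _ snd uv cvg_snd).
Qed.

Lemma enorm_shift_le1 e w z p lam :
  nearly_singular q a b xb wb 1 e w z p lam ->
  enorm (q xb w - q xb wb) <= e * enorm (z - xb).
Proof.
move=> [_ + _ _ _]; apply: le_trans.
by rewrite /err invr1 powRr1 ?enorm_ge0// lerDr opnorm_ge0.
Qed.

(** With exponent [1/2] the error controls the square root of the shift of the
value, so the shift itself is of second order in [enorm (z - xb)]. *)
Lemma enorm_shift_le2 e w z p lam : e <= 1 ->
  nearly_singular q a b xb wb 2 e w z p lam ->
  enorm (q xb w - q xb wb) <= e * enorm (z - xb) ^+ 2.
Proof.
move=> e1 [/andP[t0 te] + _ _ _].
rewrite /err powR12_sqrt ?enorm_ge0// => err_le.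
have sq : Num.sqrt (enorm (q xb w - q xb wb)) <= e * enorm (z - xb).
  by apply: le_trans err_le; rewrite lerDr opnorm_ge0.
rewrite -[leLHS]sqr_sqrtr ?enorm_ge0//.
apply: le_trans (_ : (e * enorm (z - xb)) ^+ 2 <= _).
  have e0 := le_trans (ltW t0) te.
  by rewrite ler_pXn2r// ?nnegrE ?sqrtr_ge0// mulr_ge0// enorm_ge0.
have e0 := lt_le_trans t0 te.
by rewrite exprMn ler_pM2r ?exprn_gt0// expr2 ler_piMl// ltW.
Qed.

Lemma first_order_property_R : smoothness_assumption q xb wb ->
  FOSCMS q P wb xb -> property_R q P xb wb 1.
Proof.
move=> smooth fo; apply: contrapT => notR.
have [e_ [w_ [z_ [p_ [lam_ [u [lam [e1 e0 ns hu lamc]]]]]]]] :=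
  not_property_R_sequences smooth notR.
have close j := enorm_shift_le1 (ns j).
have /eqP[] := limit_multiplier_neq0 ns lamc.
apply: (fo u).
- exact: limit_direction_neq0 ns hu.
- exact: limit_in_linearized_tangent_cone e1 e0 ns hu close.
- exact: multiplier_in_kernel e0 ns lamc.
- exact: limit_in_directional_normal_cone e1 e0 ns hu lamc close.
Qed.

Lemma second_order_property_R : smoothness_assumption q xb wb ->
  (forall u, u != 0 -> linearized_tangent_cone q P wb xb u ->
    forall lambda : 'rV[R]_m, lambda *m (Dx q xb wb)^T = 0 ->
      directional_normal_cone (q xb wb) P (u *m Dx q xb wb) lambda ->
      quadform (hess_x q lambda xb wb) u = 0 -> lambda = 0) ->
  property_R q P xb wb 2.
Proof.
move=> smooth so; apply: contrapT => notR.
have [e_ [w_ [z_ [p_ [lam_ [u [lam [e1 e0 ns hu lamc]]]]]]]] :=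
  not_property_R_sequences smooth notR.
have close2 j := enorm_shift_le2 (e1 j) (ns j).
have close j : enorm (q xb (w_ j) - q xb wb) <= e_ j * enorm (z_ j - xb).
  apply: le_trans (close2 j) _; have [/andP[t0 te] _ _ _ _] := ns j.
  rewrite ler_pM2l ?(lt_le_trans t0)// expr2 ler_piMl ?(ltW t0)//.
  exact: le_trans te (e1 j).
have [U0 [W0 [/nbhs_enormP[d d0 Ud] /nbhs_singleton W0b qdiff _ _]]] := smooth.
have diff_b : \forall y \near xb, differentiable (q^~ wb) y.
  apply: filterS (near_enorm xb d0) => y yd.
  by have [] := qdiff y wb (Ud _ yd) W0b.
have diffD_b : differentiable ((Dx q)^~ wb) xb.
  by have [] := qdiff xb wb (Ud _ _) W0b; rewrite ?subrr ?enorm0.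
have /eqP[] := limit_multiplier_neq0 ns lamc.
apply: (so u).
- exact: limit_direction_neq0 ns hu.
- exact: limit_in_linearized_tangent_cone e1 e0 ns hu close.
- exact: multiplier_in_kernel e0 ns lamc.
- exact: limit_in_directional_normal_cone e1 e0 ns hu lamc close.
- exact: limit_quadform_eq0 e1 e0 ns hu lamc close close2 diff_b diffD_b.
Qed.

End Conclusion.

Theorem proposition1 (R : realType) (n m : nat) (Omega : topologicalType)
    (q : 'rV[R]_n -> Omega -> 'rV[R]_m)
    (p : nat) (k : 'I_p -> nat)
    (a : forall i : 'I_p, 'I_(k i) -> 'rV[R]_m)
    (b : forall i : 'I_p, 'I_(k i) -> R)
    (P : set 'rV[R]_m)
    (xb : 'rV[R]_n) (wb : Omega)
    (hq : continuous (fun z : 'rV[R]_n * Omega => q z.1 z.2))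
    (hP : P = \bigcup_(i in [set: 'I_p]) convex_polyhedron (a i) (b i))
    (hxb : feasible q P wb xb)
    (hsmooth : smoothness_assumption q xb wb) :
  (FOSCMS q P wb xb -> property_R q P xb wb 1) /\
  ((forall u, u != 0 -> linearized_tangent_cone q P wb xb u ->
    forall lambda : 'rV[R]_m,
      lambda *m (Dx q xb wb)^T = 0 ->
      directional_normal_cone (q xb wb) P (u *m Dx q xb wb) lambda ->
      quadform (hess_x q lambda xb wb) u = 0 ->
      lambda = 0) ->
   property_R q P xb wb 2) /\
  (SOSCMS q P wb xb -> property_R q P xb wb 2).
Proof.
subst P; split; first exact: first_order_property_R.
have second := second_order_property_R hsmooth.
split; first exact: second.
move=> so; apply: second => u u0 ut lam lamD lamN lam0.
by apply: (so u u0 ut lam lamD lamN); rewrite lam0.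
Qed.
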